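(* The set $F_{\{0,1,2\}}$ of probability measures on $\mathbb{R}$ supported in $\{0,1,2\}$ is good. More generally, let $\mu_1,\mu_2,\mu_3\in P^+$ and let $$L:=\{a_1\mu_1+a_2\mu_2+a_3\mu_3 \mid a_1+a_2+a_3=1,\ a_1,a_2,a_3\ge 0\}.$$ Then $L$ is good.
   Context: $P(\mathbb{R})$ denotes the set of Borel probability measures on $\mathbb{R}$, with the $\sigma$-algebra generated by the maps $\mu\mapsto\mu(B)$, $B\subset\mathbb{R}$ Borel; $P(P(\mathbb{R}))$ is the set of probability measures on $P(\mathbb{R})$; $P^+\subset P(\mathbb{R})$ is the set of those $\mu$ supported in $[0,\infty)$. For $\Theta\in P(P(\mathbb{R}))$, a sequence $X=(X_j)_{j\in\mathbb{N}}$ of real random variables is iid-$\Theta$ if $\mathbb{P}(X\in B)=\int\theta^{\mathbb{N}}(B)\,d\Theta(\theta)$ for all Borel $B\subset\mathbb{R}^{\mathbb{N}}$, where $\theta^{\mathbb{N}}$ is the infinite product measure. A measurable set $L\subset P(\mathbb{R})$ is called good if the following holds: whenever $\Theta_1,\Theta_2\in P(P(\mathbb{R}))$ are concentrated on $L$, $X$ is iid-$\Theta_1$, $Y$ is iid-$\Theta_2$, and $\sum_{j=1}^n X_j$ and $\sum_{j=1}^n Y_j$ have the same distribution for every $n\ge 1$, then $\Theta_1=\Theta_2$. *)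

(* Defs.v *)
From mathcomp Require Import all_boot all_order all_algebra.
From mathcomp Require Import all_classical all_reals all_analysis.
From mathcomp Require Import measurable_realfun.

Set Implicit Arguments.
Unset Strict Implicit.
Unset Printing Implicit Defensive.

Import Order.TTheory GRing.Theory Num.Theory.
Import numFieldNormedType.Exports.

Local Open Scope classical_set_scope.
Local Open Scope ring_scope.

Section good_sets.
Context (R : realType).

Definition probR := pprobability R R.

(* The Borel sigma-algebra of the product topology. *)
Definition seqR := g_sigma_algebraType (@open (prod_topology (fun _ : nat => R))).

(* The values on rectangles determine a probability on seqR: this says that m
   is the infinite product measure theta^N. *)
Definition infinite_product (theta : probR) (m : probability seqR R) : Prop :=
  forall (n : nat) (A : nat -> set R), (forall i, measurable (A i)) ->
    m [set x | forall i, (i < n)%N -> A i (x i)] =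
    (\prod_(i < n) theta (A i))%E.

(* prodN is the map theta |-> theta^N: such a map exists, and prodN theta B is
   determined by theta for measurable B. *)
Definition iid (Th : probability probR R) (d : measure_display)
    (T : measurableType d) (P : probability T R)
    (X : nat -> {RV P >-> R}) : Prop :=
  exists2 prodN : probR -> probability seqR R,
    forall theta, infinite_product theta (prodN theta) &
    forall B : set seqR, measurable B ->
      P [set t | B (X ^~ t)] = (\int[Th]_theta prodN theta B)%E.

(* "Concentrated on L" is Th L = 1. Equality of Th1 and Th2 is stated on
   measurable sets because the type of probabilities also records values on
   nonmeasurable ones; the same applies in convex_hull3 below. *)
Definition good (L : set probR) : Prop :=
  measurable L /\
  forall Th1 Th2 : probability probR R,
    Th1 L = 1%E -> Th2 L = 1%E ->
  forall (d1 d2 : measure_display)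
    (T1 : measurableType d1) (T2 : measurableType d2)
    (P1 : probability T1 R) (P2 : probability T2 R)
    (X : nat -> {RV P1 >-> R}) (Y : nat -> {RV P2 >-> R}),
    iid Th1 X -> iid Th2 Y ->
    (forall n : nat, (0 < n)%N -> forall B : set R, measurable B ->
       distribution P1 (\sum_(j < n) X j) B =
       distribution P2 (\sum_(j < n) Y j) B) ->
  forall A : set probR, measurable A -> Th1 A = Th2 A.

(* Intended for closed S, where it says that S contains the support. *)
Definition supported_in (S : set R) : set probR := [set theta | theta S = 1%E].

Definition convex_hull3 (mu1 mu2 mu3 : probR) : set probR :=
  [set theta | exists a1 a2 a3 : R,
    [/\ a1 + a2 + a3 = 1, 0 <= a1, 0 <= a2, 0 <= a3 &
      forall B : set R, measurable B ->
        theta B = (a1%:E * mu1 B + a2%:E * mu2 B + a3%:E * mu3 B)%E]].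

End good_sets.

(* Main.v *)
Require Import Defs.
From mathcomp Require Import all_boot all_order all_algebra.
From mathcomp Require Import measurable_realfun.
From mathcomp Require Import all_classical all_reals all_analysis.
From mathcomp Require Import ring lra.

(**
The Laplace transform of X_1 + ... + X_n at t is the integral of [theta^(t) ^ n]
with respect to Theta, where theta^ is the Laplace transform of theta. So the
hypothesis says that all moments of [theta^(t)] are the same under Theta_1 and
Theta_2, for each t. On L, write theta = mu3 + a1 (mu1 - mu3) + a2 (mu2 - mu3);
then [theta^(t)] is affine in (a1, a2), with linear part
[d(t) = ((mu1 - mu3)^(t), (mu2 - mu3)^(t))].

If the vectors d(t) are all parallel, then so are the values of the vector
measure (mu1 - mu3, mu2 - mu3), and one functional [theta^(t)] determines theta.
Otherwise choose t1 < t2 with d(t1), d(t2) independent and expand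
d(t) = a(t) d(t1) + b(t) d(t2). The differences of the mixed moments of
[theta^(t1)] and [theta^(t2)] of degree n are, up to binomial factors, the
coefficients of a binary form vanishing at (a(t), b(t)) for all t. As
(a, b)(t2) = (0, 1) and a is the Laplace transform of a signed measure, which
vanishes on no interval of the form [t2, t2 + e] because a(t1) = 1, this form is zero.

In both cases the mixed moments of theta(B_1), ..., theta(B_k) agree, and these
determine Theta.
*)

Set Implicit Arguments.
Unset Strict Implicit.
Unset Printing Implicit Defensive.

Import Order.TTheory GRing.Theory Num.Theory.
Import numFieldNormedType.Exports.

Local Open Scope classical_set_scope.
Local Open Scope ring_scope.

(** * Bounded functions and continuous functionals *)

Section bounded_measurable.
Context d (T : measurableType d) (R : realType).
Implicit Types f g : T -> R.

Definition bfun f := measurable_fun [set: T] f /\ exists M, forall x, `|f x| <= M.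

Lemma bfun_cst (c : R) : bfun (fun=> c).
Proof. by split; [exact: measurable_cst|exists `|c|]. Qed.

Lemma bfunD f g : bfun f -> bfun g -> bfun (fun x => f x + g x).
Proof.
move=> [mf [M fM]] [mg [N gN]]; split; first exact: measurable_funD.
by exists (M + N) => x; rewrite (le_trans (ler_normD _ _))// lerD.
Qed.

Lemma bfunM f g : bfun f -> bfun g -> bfun (fun x => f x * g x).
Proof.
move=> [mf [M fM]] [mg [N gN]]; split; first exact: measurable_funM.
by exists (M * N) => x; rewrite normrM ler_pM.
Qed.

Lemma bfunZ c f : bfun f -> bfun (fun x => c * f x).
Proof. by move=> bf; apply: bfunM => //; exact: bfun_cst. Qed.

Lemma bfunN f : bfun f -> bfun (fun x => - f x).
Proof. by move=> /(bfunZ (-1)); under eq_fun do rewrite mulN1r. Qed.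

Lemma bfunB f g : bfun f -> bfun g -> bfun (fun x => f x - g x).
Proof. by move=> bf bg; apply: bfunD => //; exact: bfunN. Qed.

Lemma bfunX f n : bfun f -> bfun (fun x => f x ^+ n).
Proof.
move=> bf; elim: n => [|n ih]; first exact: bfun_cst.
by under eq_fun do rewrite exprS; exact: bfunM.
Qed.

Lemma bfun_sum I (s : seq I) (P : pred I) (F : I -> T -> R) :
  (forall i, P i -> bfun (F i)) -> bfun (fun x => \sum_(i <- s | P i) F i x).
Proof.
move=> bF; elim: s => [|i s ih].
  by under eq_fun do rewrite big_nil; exact: bfun_cst.
under eq_fun do rewrite big_cons; case: (boolP (P i)) => // Pi.
by apply: bfunD => //; exact: bF.
Qed.

Lemma bfun_prod I (s : seq I) (P : pred I) (F : I -> T -> R) :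
  (forall i, P i -> bfun (F i)) -> bfun (fun x => \prod_(i <- s | P i) F i x).
Proof.
move=> bF; elim: s => [|i s ih].
  by under eq_fun do rewrite big_nil; exact: bfun_cst.
under eq_fun do rewrite big_cons; case: (boolP (P i)) => // Pi.
by apply: bfunM => //; exact: bF.
Qed.

Lemma bfun_indic (A : set T) : measurable A -> bfun \1_A.
Proof.
move=> mA; split; first exact: measurable_indic.
by exists 1 => x; rewrite indicE; case: (_ \in _); rewrite ?normr0 ?normr1.
Qed.

Lemma bfun_ge0_le1 f : measurable_fun setT f -> (forall x, 0 <= f x <= 1) ->
  bfun f.
Proof.
move=> mf f01; split => //; exists 1 => x.
by have /andP[f0 f1] := f01 x; rewrite ger0_norm.
Qed.

Lemma bfun_integrable (P : probability T R) f : bfun f ->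
  P.-integrable setT (EFin \o f).
Proof.
move=> [mf [M fM]]; apply: (@le_integrable _ _ _ P setT _ _ (EFin \o cst M)) => //.
- exact/measurable_EFinP.
- move=> x _ /=; rewrite lee_fin (le_trans (fM x))//.
  exact: ler_norm.
- by apply: finite_measure_integrable_cst.
Qed.

(* Functionals that are linear and continuous under bounded pointwise convergence,
   i.e., integrals against finite signed measures. *)
Definition bpc (Phi : (T -> R) -> R) :=
  (forall a f g, bfun f -> bfun g ->
    Phi (fun x => a * f x + g x) = a * Phi f + Phi g) /\
  (forall (f_ : nat -> T -> R) f M, (forall n, bfun (f_ n)) ->
    (forall n x, `|f_ n x| <= M) -> (forall x, f_ ^~ x @ \oo --> f x) ->
    Phi (f_ n) @[n --> \oo] --> Phi f).

End bounded_measurable.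

Section bpc_theory.
Context d (T : measurableType d) (R : realType).
Implicit Types (f g W : T -> R) (Phi Psi : (T -> R) -> R).

Lemma bpc0 Phi : bpc Phi -> Phi (fun=> 0) = 0.
Proof.
move=> [lin _]; have := lin 1 _ _ (@bfun_cst _ T R 0) (@bfun_cst _ T R 0).
under [X in Phi X = _]eq_fun do rewrite mul1r addr0.
by move/eqP; rewrite mul1r -subr_eq subrr eq_sym => /eqP.
Qed.

Lemma bpcZ Phi a f : bpc Phi -> bfun f -> Phi (fun x => a * f x) = a * Phi f.
Proof.
move=> bPhi bf; have [lin _] := bPhi.
have := lin a _ _ bf (@bfun_cst _ T R 0).
by under [X in Phi X = _]eq_fun do rewrite addr0; rewrite bpc0 ?addr0.
Qed.

Lemma bpcD Phi f g : bpc Phi -> bfun f -> bfun g ->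
  Phi (fun x => f x + g x) = Phi f + Phi g.
Proof.
move=> bPhi bf bg; have [lin _] := bPhi.
have := lin 1 _ _ bf bg.
by under [X in Phi X = _]eq_fun do rewrite mul1r; rewrite mul1r.
Qed.

Lemma bpcB Phi f g : bpc Phi -> bfun f -> bfun g ->
  Phi (fun x => f x - g x) = Phi f - Phi g.
Proof.
move=> bPhi bf bg; rewrite bpcD//; last exact: bfunN.
under [X in _ + Phi X = _]eq_fun do rewrite -mulN1r.
by rewrite bpcZ// mulN1r.
Qed.

Lemma bpc_sum Phi I (s : seq I) (P : pred I) (F : I -> T -> R) :
  bpc Phi -> (forall i, P i -> bfun (F i)) ->
  Phi (fun x => \sum_(i <- s | P i) F i x) = \sum_(i <- s | P i) Phi (F i).
Proof.
move=> bPhi bF; elim: s => [|i s ih].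
  by under eq_fun do rewrite big_nil; rewrite big_nil bpc0.
under eq_fun do rewrite big_cons; rewrite big_cons.
case: (boolP (P i)) => // Pi; rewrite bpcD ?ih//; first exact: bF.
exact: bfun_sum.
Qed.

(** Continuity is dominated convergence: on a probability space the uniform bound [M] is itself an
    integrable dominating function. *)
Lemma bpc_integral (P : probability T R) : bpc (fun f => \int[P]_x f x).
Proof.
split=> [a f g bf bg|f_ f M bf_ fM ff].
  rewrite RintegralD//; last exact: bfun_integrable.
    rewrite RintegralZl//; exact: bfun_integrable.
  by apply: (@bfun_integrable _ _ _ P (fun x => a * f x)); exact: bfunZ.
have mf : measurable_fun setT f.
  by apply: (@measurable_fun_cvg _ _ _ _ f_) => [n|x _]; [have [] := bf_ n|exact: ff].
have Mint : P.-integrable setT (EFin \o cst M).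
  exact: finite_measure_integrable_cst.
have mf_ n : measurable_fun setT (EFin \o f_ n).
  by apply/measurable_EFinP; have [] := bf_ n.
have mEf : measurable_fun setT (EFin \o f) by exact/measurable_EFinP.
have cf : {ae P, forall x, [set: T] x -> (EFin \o f_ n) x @[n --> \oo] --> (EFin \o f) x}.
  by apply/aeW => x _; apply: cvg_EFin; [exact: nearW|exact: ff].
have df : {ae P, forall x n, [set: T] x -> (`|(EFin \o f_ n) x| <= (EFin \o cst M) x)%E}.
  by apply/aeW => x n _ /=; rewrite lee_fin.
have [intf _ cvgf] := dominated_convergence measurableT mf_ mEf cf Mint df.
by apply: fine_cvg; rewrite fineK//; exact: integrable_fin_num.
Qed.

Lemma bpc_cvg_eq0 Phi (f_ : nat -> T -> R) f M : bpc Phi ->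
  (forall n, bfun (f_ n)) -> (forall n x, `|f_ n x| <= M) ->
  (forall x, f_ ^~ x @ \oo --> f x) -> (forall n, Phi (f_ n) = 0) -> Phi f = 0.
Proof.
move=> [_ cP] bf fM ff Phi0; have := cP _ _ _ bf fM ff.
under eq_fun do rewrite Phi0.
by move=> /(cvg_unique _ (cvg_cst _)) => /(_ (@norm_hausdorff _ _))<-.
Qed.

Lemma bpc_lincomb Phi Psi a b : bpc Phi -> bpc Psi ->
  bpc (fun f => a * Phi f + b * Psi f).
Proof.
move=> [lP cP] [lQ cQ]; split=> [c f g bf bg|f_ f M bf fM ff].
  by rewrite lP// lQ//; ring.
by apply: cvgD; apply: cvgMr; [exact: cP bf fM ff|exact: cQ bf fM ff].
Qed.

Lemma bpc_weight Phi W : bpc Phi -> bfun W -> bpc (fun f => Phi (fun x => W x * f x)).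
Proof.
move=> [lP cP] bW; split=> [c f g bf bg|f_ f M bf fM ff].
  rewrite -lP; [|exact: bfunM|exact: bfunM].
  by congr Phi; apply/funext => x; ring.
have [_ [N WN]] := bW.
apply: (cP _ _ (N * M)) => [n|n x|x]; first exact: bfunM.
  by rewrite normrM ler_pM.
by apply: cvgMr; exact: ff.
Qed.

End bpc_theory.

Lemma bfun_comp d d' (T : measurableType d) (T' : measurableType d')
    (R : realType) (X : T -> T') (f : T' -> R) :
  measurable_fun setT X -> bfun f -> bfun (f \o X).
Proof.
move=> mX [mf [M fM]]; split; first exact: measurableT_comp.
by exists M => x; exact: fM.
Qed.

Lemma bpc_comp d d' (T : measurableType d) (T' : measurableType d')
    (R : realType) (X : T -> T') (Phi : (T -> R) -> R) :
  measurable_fun setT X -> bpc Phi -> bpc (fun f : T' -> R => Phi (f \o X)).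
Proof.
move=> mX [lP cP]; split=> [c f g bf bg|f_ f M bf fM ff].
  by rewrite -lP//; exact: bfun_comp.
apply: (cP _ _ M) => [n|n x|x]; first exact: bfun_comp.
- exact: fM.
- exact: ff.
Qed.

Section monotone_class.
Context d (T : measurableType d) (R : realType).
Implicit Types (f g W : T -> R) (Phi Psi : (T -> R) -> R).
Import HBNNSimple.

(** Simple functions reach every bounded measurable function by bounded pointwise limits.
    Approximation from below needs a nonnegative function, so [f] is first shifted by its bound;
    constants are multiples of the indicator of the whole space. *)
Lemma bpc_indic_eq0 Phi f : bpc Phi ->
  (forall A, measurable A -> Phi \1_A = 0) -> bfun f -> Phi f = 0.
Proof.
move=> bPhi Phi0 bf; have [mf [M fM]] := bf.
have M1 : Phi (fun=> M) = 0.
  rewrite (_ : (fun=> M) = (fun x => M * \1_[set: T] x)); last first.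
    by apply/funext => x; rewrite indicE in_setT mulr1.
  by rewrite bpcZ// ?Phi0 ?mulr0//; exact: bfun_indic.
pose h x := f x + M.
have h0 x : 0 <= h x.
  by have := fM x; rewrite ler_norml /h => /andP[]; rewrite -subr_ge0 opprK.
have bh : bfun h by apply: bfunD => //; exact: bfun_cst.
suff : Phi h = 0 by rewrite bpcD ?M1 ?addr0//; exact: bfun_cst.
have mh : measurable_fun setT (EFin \o h).
  by apply/measurable_EFinP; case: bh.
pose g := nnsfun_approx measurableT mh.
have gh n x : g n x <= h x.
  rewrite -lee_fin /g nnsfun_approxE; apply: le_approx => // y _.
  by rewrite lee_fin.
have Phig n : Phi (g n) = 0.
  have -> : (g n : T -> R) = (fun x => \sum_(r \in range (g n))
      r * \1_((g n) @^-1` [set r]) x) by apply/funext => x; exact: fimfunE.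
  under eq_fun do rewrite fsbig_finite//=.
  rewrite bpc_sum// => [|r _]; last by apply: bfunZ; exact: bfun_indic.
  rewrite big1// => r _; rewrite bpcZ ?Phi0 ?mulr0//.
  exact: bfun_indic.
have [_ [N hN]] := bh.
apply: (@bpc_cvg_eq0 _ _ _ Phi (fun n => g n) h N) => //.
- move=> n; split; first exact: measurable_funPT.
  exists N => x; rewrite ger0_norm// (le_trans (gh n x))//.
  exact: le_trans (ler_norm _) (hN x).
- move=> n x; rewrite ger0_norm// (le_trans (gh n x))//.
  exact: le_trans (ler_norm _) (hN x).
- move=> x; apply: (@fine_cvg _ _ _ _ (fun n => (g n x)%:E)).
  by apply: cvg_nnsfun_approx => // y _; rewrite lee_fin.
Qed.

End monotone_class.

(** * Moments and Laplace transforms *)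

Section pi_lambda.
Context d (T : measurableType d) (R : realType).
Implicit Types (Phi : (T -> R) -> R).

(** Complements use the vanishing on constants. For a disjoint union the partial sums of indicators
    stay below 1, so the convergence is bounded. *)
Lemma bpc_dynkin Phi : bpc Phi -> Phi (fun=> 1) = 0 ->
  dynkin [set A | measurable A /\ Phi \1_A = 0].
Proof.
move=> bPhi Phi1; split => [|A [mA A0]|F tF mF].
- by split => //; rewrite indicT.
- split; first exact: measurableC.
  rewrite (_ : \1_(~` A) = (fun x => 1 - \1_A x)).
    by rewrite bpcB ?Phi1 ?A0 ?subrr//; [exact: bfun_cst|exact: bfun_indic].
  by apply/funext => x; rewrite indicC indicE; case: (x \in A); rewrite ?subrr ?subr0.
- split; first by apply: bigcup_measurable => n _; have [] := mF n.
  apply: (@bpc_cvg_eq0 _ _ _ Phi (fun n x => \sum_(0 <= k < n) \1_(F k) x) _ 1) => //.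
  + by move=> n; apply: bfun_sum => k _; apply: bfun_indic; have [] := mF k.
  + move=> n x; rewrite ger0_norm ?sumr_ge0//.
    rewrite -lee_fin -sumEFin.
    rewrite (@le_trans _ _ (\sum_(0 <= k <oo) (\1_(F k) x)%:E)%E)//.
      by apply: nneseries_lim_ge => k _ _; rewrite lee_fin.
    by rewrite -indic_bigcup// lee_fin indicE lern1 leq_b1.
  + move=> x; apply: (@fine_cvg _ _ _ _ (fun n => (\sum_(0 <= k < n) \1_(F k) x)%:E)).
    rewrite indic_bigcup//.
    under eq_fun do rewrite -sumEFin.
    by apply: is_cvg_nneseries => k _ _; rewrite lee_fin.
  + move=> n; rewrite bpc_sum// => [|k _]; last by apply: bfun_indic; have [] := mF k.
    by rewrite big1// => k _; have [] := mF k.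
Qed.

Lemma bpc_pi_system Phi (G : set (set T)) : bpc Phi -> Phi (fun=> 1) = 0 ->
  setI_closed G -> @measurable _ T = <<s G >> ->
  (forall A, G A -> Phi \1_A = 0) -> forall A, measurable A -> Phi \1_A = 0.
Proof.
move=> bPhi Phi1 GI mG PhiG A; rewrite mG -setI_closed_g_dynkin_g_sigma_algebra//.
have sub : <<d G >> `<=` [set A | measurable A /\ Phi \1_A = 0].
  apply: smallest_sub; first exact: bpc_dynkin.
  by move=> B GB; split; [rewrite mG; exact: sub_sigma_algebra|exact: PhiG].
by move=> /sub[].
Qed.

End pi_lambda.

Lemma indic_preimage T T' (R : realType) (X : T -> T') (C : set T') :
  \1_(X @^-1` C) = \1_C \o X :> (T -> R).
Proof. by []. Qed.

(** The half-lines []a, +oo[] form a pi-system generating the Borel sets, and their preimages are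
    the complements of the given level sets. *)
Lemma bpc_borel d (T : measurableType d) (R : realType) (X : T -> R)
    (Phi : (T -> R) -> R) : bpc Phi -> measurable_fun setT X ->
  Phi (fun=> 1) = 0 ->
  (forall c, Phi \1_[set x | X x <= c] = 0) ->
  forall C, measurable C -> Phi \1_(X @^-1` C) = 0.
Proof.
move=> bPhi mX Phi1 PhiX C mC; rewrite indic_preimage.
apply: (bpc_pi_system (bpc_comp mX bPhi) Phi1 _ (RGenOInfty.measurableE R)) => //.
- move=> _ _ [a ->] [b ->]; exists (Num.max a b).
  by apply/seteqP; split=> x /=; rewrite !in_itv/= !andbT gt_max => /andP.
- move=> _ [a ->].
  rewrite (_ : _ \o X = fun x => 1 - \1_[set x | X x <= a] x).
    rewrite bpcB ?Phi1 ?PhiX ?subrr//; [exact: bfun_cst|apply: bfun_indic].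
    by rewrite -[X in measurable X]setTI; exact: measurable_fun_le.
  apply/funext => x; rewrite /= !indicE.
  have -> : (X x \in `]a, +oo[%classic) = ~~ (X x <= a).
    by rewrite -ltNge; apply/idP/idP; rewrite inE/= in_itv/= andbT.
  have -> : (x \in [set x | X x <= a]) = (X x <= a) by apply/idP/idP; rewrite inE.
  by case: (X x <= a); rewrite ?subrr ?subr0.
Qed.

Section hausdorff_moment.
Context d (T : measurableType d) (R : realType).
Implicit Types (Phi : (T -> R) -> R).

Lemma bpc_horner Phi (X : T -> R) (p : {poly R}) : bpc Phi -> bfun X ->
  (forall k, Phi (fun x => X x ^+ k) = 0) -> Phi (fun x => p.[X x]) = 0.
Proof.
move=> bPhi bX PhiX; under eq_fun do rewrite horner_coef.
rewrite bpc_sum// => [|i _]; last by apply: bfunZ; exact: bfunX.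
by rewrite big1// => i _; rewrite bpcZ ?PhiX ?mulr0//; exact: bfunX.
Qed.

Lemma bernoulli_le (s : R) n : -1 <= s -> 1 + n%:R * s <= (1 + s) ^+ n.
Proof.
move=> s1; elim: n => [|n ih]; first by rewrite mul0r addr0 expr0.
rewrite exprSr -natr1.
have : (1 + n%:R * s) * (1 + s) <= (1 + s) ^+ n * (1 + s).
  by rewrite ler_wpM2r//; lra.
apply: le_trans; have : 0 <= n%:R * s ^+ 2 by rewrite mulr_ge0// sqr_ge0.
by rewrite expr2; lra.
Qed.

(** Bernoulli's inequality for the square root of [b], squared. Quadratic growth is needed because
    the exponent in [step_poly] divides by [n.+1] and a decay of order [1 / n.+1] must still
    remain. *)
Lemma expn_ge_sqr (b : R) : 1 < b ->
  exists2 s, 0 < s & forall n, s * n.+1%:R ^+ 2 <= b ^+ n.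
Proof.
move=> b1; pose r := Num.sqrt b - 1.
have r0 : 0 < r by rewrite subr_gt0 -sqrtr1 ltr_sqrt// (lt_trans ltr01).
(* With [s] below both 1 and [r], [s * n.+1] is at most [1 + n * r]. *)
pose s := Num.min 1 r.
have s0 : 0 < s by rewrite lt_min ltr01.
exists (s ^+ 2) => [|n]; first by rewrite exprn_gt0.
have -> : b ^+ n = ((1 + r) ^+ n) ^+ 2.
  by rewrite -exprM mulnC exprM /r addrC subrK sqr_sqrtr// ltW// (lt_trans ltr01).
have r1 : 0 <= 1 + r by rewrite addr_ge0// ltW.
rewrite -exprMn lerXn2r ?nnegrE ?mulr_ge0 ?exprn_ge0 ?(ltW s0)//.
rewrite (le_trans _ (@bernoulli_le r n _))//; last by lra.
have : s <= 1 by rewrite ge_min lexx.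
have : s <= r by rewrite ge_min lexx orbT.
rewrite -natr1 => sr s1.
have : n%:R * s <= n%:R * r by rewrite ler_wpM2l.
lra.
Qed.

(* The exponent is negligible compared to [x ^- n] for [x <= c] and dominates it
   for [x > c]. *)
Definition step_poly (c : R) (n : nat) : {poly R} :=
  (1 - 'X^n) ^+ Num.trunc (c ^- n / n.+1%:R).

Lemma step_polyE c n x :
  (step_poly c n).[x] = (1 - x ^+ n) ^+ Num.trunc (c ^- n / n.+1%:R).
Proof. by rewrite /step_poly horner_exp !hornerE. Qed.

Lemma step_poly_ge0_le1 (c : R) n x : 0 <= x <= 1 -> 0 <= (step_poly c n).[x] <= 1.
Proof.
move=> /andP[x0 x1]; rewrite step_polyE.
have xn0 : 0 <= x ^+ n by rewrite exprn_ge0.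
have xn1 : x ^+ n <= 1 by rewrite exprn_ile1.
by rewrite exprn_ge0 ?exprn_ile1//; lra.
Qed.

(** Let [N] be the exponent. For [x <= c], Bernoulli gives the lower bound [1 - N x^n], which is at
    least [1 - 1 / n.+1]. For [x > c], the value is at most [1 / (1 + N x^n)], and [1 + N x^n] grows
    at least linearly. *)
Lemma step_poly_cvg (c x : R) : 0 < c -> 0 <= x <= 1 ->
  (step_poly c n).[x] @[n --> \oo] --> ((x <= c)%R%:R : R).
Proof.
move=> c0 x01; have /andP[x0 x1] := x01.
have xn0 n : 0 <= x ^+ n by rewrite exprn_ge0.
have xn1 n : x ^+ n <= 1 by rewrite exprn_ile1.
have trn0 n : 0 <= c ^- n / n.+1%:R by rewrite divr_ge0// invr_ge0 exprn_ge0// ltW.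
have [xc|cx] /= := leP x c.
- apply: (@squeeze_cvgr _ _ _ _ (fun n => 1 - harmonic n) (cst 1)); last 2 first.
  + by rewrite -[X in _ --> X]subr0; apply: cvgB; [exact: cvg_cst|exact: cvg_harmonic].
  + exact: cvg_cst.
  near=> n; have /andP[_ ->] := step_poly_ge0_le1 c n x01; rewrite andbT.
  rewrite step_polyE.
  apply: le_trans (@bernoulli_le (- x ^+ n) _ _); last by rewrite lerN2.
  rewrite lerD2l mulrN lerN2.
  have /andP[+ _] := truncn_itv (trn0 n).
  move=> /(ler_wpM2r (xn0 n))/le_trans; apply.
  rewrite /harmonic/= mulrAC ler_piMl ?invr_ge0//.
  rewrite ler_pdivrMl ?mulr1 ?exprn_gt0//.
  by rewrite lerXn2r ?nnegrE ?(ltW c0).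
- have xc1 : 1 < x / c by rewrite ltr_pdivlMr ?mul1r.
  have [s s0 sb] := expn_ge_sqr xc1.
  apply: (@squeeze_cvgr _ _ _ _ (cst 0) (fun n => s^-1 * harmonic n)); last 2 first.
  + exact: cvg_cst.
  + by rewrite -[X in _ --> X](mulr0 s^-1); apply: cvgMr; exact: cvg_harmonic.
  near=> n; have /andP[-> _] := step_poly_ge0_le1 c n x01; rewrite /=.
  rewrite step_polyE; set N := Num.trunc _.
  have xnN : 1 <= 1 + N%:R * x ^+ n by rewrite lerDl mulr_ge0.
  (* With [y = x^n], Bernoulli bounds the product by [(1 - y)^N (1 + y)^N = (1 - y^2)^N]. *)
  have : (1 - x ^+ n) ^+ N * (1 + N%:R * x ^+ n) <= 1.
    apply: (@le_trans _ _ ((1 - x ^+ n) ^+ N * (1 + x ^+ n) ^+ N)).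
      rewrite ler_wpM2l ?exprn_ge0 ?subr_ge0//.
      by apply: bernoulli_le; rewrite (le_trans _ (xn0 n))// lerN10.
    rewrite -exprMn -subr_sqr expr1n exprn_ile1//.
      by rewrite subr_ge0 exprn_ile1.
    by rewrite gerBl sqr_ge0.
  rewrite -ler_pdivlMr ?(lt_le_trans ltr01)// => /le_trans; apply.
  rewrite div1r /harmonic/= -invfM lef_pV2 ?posrE ?mulr_gt0 ?(lt_le_trans ltr01 xnN)//.
  have /andP[_ Nc] := truncn_itv (trn0 n).
  have : s * n.+1%:R ^+ 2 / n.+1%:R <= (x / c) ^+ n / n.+1%:R.
    by rewrite ler_wpM2r ?invr_ge0.
  rewrite expr2 mulrA mulfK ?pnatr_eq0// => /le_trans; apply.
  rewrite expr_div_n -mulrA mulrC.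
  (* Since [x^n <= 1], the summand 1 in [1 + N x^n] makes up for the rounding down in [N]. *)
  move: Nc => /ltW/(ler_wpM2r (xn0 n))/le_trans; apply.
  by rewrite -natr1 mulrDl mul1r addrC lerD2r.
Unshelve. all: by end_near. Qed.

Lemma hausdorff_moment_le Phi (X : T -> R) c : bpc Phi -> measurable_fun setT X ->
  (forall x, 0 <= X x <= 1) -> (forall k, Phi (fun x => X x ^+ k) = 0) ->
  Phi \1_[set x | X x <= c] = 0.
Proof.
move=> bPhi mX X01 PhiX.
have bX : bfun X by exact: bfun_ge0_le1.
have Phi1 : Phi (fun=> 1) = 0.
  by have := PhiX 0%N; under eq_fun do rewrite expr0.
have [c0|c0|c0] := ltgtP c 0.
- rewrite (_ : [set _ | _] = set0) ?indic0 ?bpc0//.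
  apply/seteqP; split=> x //=; have /andP[X0 _] := X01 x.
  by move=> /le_lt_trans/(_ c0); rewrite ltNge X0.
- apply: (@bpc_cvg_eq0 _ _ _ Phi (fun n x => (step_poly c n).[X x]) _ 1) => //.
  + move=> n; under eq_fun do rewrite horner_coef.
    by apply: bfun_sum => i _; apply: bfunZ; exact: bfunX.
  + by move=> n x; have /andP[? ?] := step_poly_ge0_le1 c n (X01 x); rewrite ger0_norm.
  + move=> x; rewrite indicE.
    have -> : (x \in [set x | X x <= c]) = (X x <= c) by apply/idP/idP; rewrite inE.
    exact: step_poly_cvg.
  + by move=> n; exact: bpc_horner.
(* At [c = 0] the exponent of [step_poly] is meaningless; the powers of [1 - X] converge to the
   indicator of the value 0 instead. *)
- apply: (@bpc_cvg_eq0 _ _ _ Phi (fun n x => ((1 - 'X) ^+ n : {poly R}).[X x]) _ 1) => //.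
  + move=> n; under eq_fun do rewrite horner_coef.
    by apply: bfun_sum => i _; apply: bfunZ; exact: bfunX.
  + move=> n x; rewrite horner_exp !hornerE.
    have /andP[? ?] := X01 x.
    by rewrite ger0_norm ?exprn_ge0 ?exprn_ile1//; lra.
  + move=> x; rewrite indicE c0.
    have -> : (x \in [set x | X x <= 0]) = (X x <= 0) by apply/idP/idP; rewrite inE.
    under eq_fun do rewrite horner_exp !hornerE.
    have /andP[X0 X1] := X01 x.
    case: (leP (X x) 0) => Xx /=.
      have -> : X x = 0 by apply/eqP; rewrite eq_le Xx.
      by under eq_fun do rewrite subr0 expr1n; exact: cvg_cst.
    have := @cvg_geometric R 1 (1 - X x).
    rewrite /geometric/=; under eq_fun do rewrite mul1r; apply.
    by rewrite ger0_norm; lra.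
  + by move=> n; exact: bpc_horner.
Qed.

End hausdorff_moment.

Lemma hausdorff_moment d (T : measurableType d) (R : realType) (X : T -> R)
    (Phi : (T -> R) -> R) : bpc Phi -> measurable_fun setT X ->
  (forall x, 0 <= X x <= 1) -> (forall k, Phi (fun x => X x ^+ k) = 0) ->
  forall C, measurable C -> Phi \1_(X @^-1` C) = 0.
Proof.
move=> bPhi mX X01 PhiX; apply: bpc_borel => //.
  by have := PhiX 0%N; under eq_fun do rewrite expr0.
by move=> c; exact: hausdorff_moment_le.
Qed.

Section laplace.
Context d (T : measurableType d) (R : realType) (X : T -> R).
Hypotheses (mX : measurable_fun setT X) (X0 : forall x, 0 <= X x).
Implicit Types (Phi : (T -> R) -> R) (t : R).

Let lap t x := expR (- (t * X x)).

Lemma laplace_ge0_le1 t x : 0 <= t -> 0 <= lap t x <= 1.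
Proof. by move=> t0; rewrite expR_ge0 -expR0 ler_expR oppr_le0 mulr_ge0. Qed.

Lemma bfun_laplace t : 0 <= t -> bfun (lap t).
Proof.
move=> t0; apply: bfun_ge0_le1 => [|x]; last exact: laplace_ge0_le1.
by apply: measurableT_comp => //; apply: measurableT_comp => //; exact: measurable_funM.
Qed.

(** The Laplace transform of [X] at an integer [k] is the [k]-th moment of [exp(-X)], which takes
    values in [0, 1]; and [X] is recovered from [exp(-X)] by a logarithm. *)
Lemma laplace_unique Phi : bpc Phi -> (forall k : nat, Phi (lap k%:R) = 0) ->
  forall C, measurable C -> Phi \1_(X @^-1` C) = 0.
Proof.
move=> bPhi Phi0 C mC.
have -> : X @^-1` C = lap 1 @^-1` ((fun y => - ln y) @^-1` C).
  by apply/seteqP; split => x; rewrite /lap /= expRK mul1r opprK.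
apply: hausdorff_moment => //.
- by have [] := @bfun_laplace 1 ler01.
- by move=> x; exact: laplace_ge0_le1.
- move=> k; have := Phi0 k; congr (Phi _ = 0); apply/funext => x.
  by rewrite /lap mul1r -expRM_natl mulrN.
- rewrite -[X in measurable X]setTI; apply: measurableT_comp => //.
Qed.

(** With [u = a / n.+1], one has [1 + r (1 - exp(-u)) <= 1 + r u <= exp(r u)]. The bound does not
    depend on [n], as bounded convergence requires. *)
Lemma laplace_exp_le (a r : R) (n : nat) : 0 <= a -> 0 <= r ->
  0 <= (1 + r - r * expR (- (a / n.+1%:R))) ^+ n.+1 <= expR (r * a).
Proof.
move=> a0 r0.
have e1 : expR (- (a / n.+1%:R)) <= 1.
  by rewrite -expR0 ler_expR oppr_le0 divr_ge0.
have b0 : 0 <= 1 + r - r * expR (- (a / n.+1%:R)).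
  by have := ler_wpM2l r0 e1; lra.
rewrite exprn_ge0//=.
have -> : r * a = n.+1%:R * (r * (a / n.+1%:R)).
  by rewrite mulrCA [n.+1%:R * _]mulrC divfK// pnatr_eq0.
rewrite expRM_natl lerXn2r ?nnegrE ?expR_ge0//.
apply: le_trans (expR_ge1Dx _).
have := @expR_ge1Dx R (- (a / n.+1%:R)).
by move: (a / _) => u /(ler_wpM2l r0); lra.
Qed.

Lemma laplace_exp_cvg (a r : R) : 0 <= a -> 0 <= r ->
  (1 + r - r * expR (- (a / n.+1%:R))) ^+ n.+1 @[n --> \oo] --> expR (r * a).
Proof.
move=> a0 r0.
(* From [exp(-u) <= 1 / (1 + u)] the base is at least [(1 + u + r u) / (1 + u)], which is at least
   [exp(r u / (1 + u + r u))]; [h n] is [n.+1] times this exponent. *)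
pose h (n : nat) := r * a / (1 + (1 + r) * a * harmonic n).
have hc : h n @[n --> \oo] --> r * a.
  rewrite -[X in _ --> X]divr1; apply: cvgMr; apply: cvgV => //.
  rewrite -[X in _ --> X]addr0; apply: cvgD; first exact: cvg_cst.
  by rewrite -[X in _ --> X](mulr0 ((1 + r) * a)); apply: cvgMr; exact: cvg_harmonic.
apply: (@squeeze_cvgr _ _ _ _ (expR \o h) (cst (expR (r * a)))); last 2 first.
- by apply: (continuous_cvg _ _ hc); exact: continuous_expR.
- exact: cvg_cst.
near=> n; have /andP[_ ->] := laplace_exp_le n a0 r0; rewrite andbT.
rewrite /h /=; set N := n.+1%:R; set u := a / N.
have N0 : 0 < N by rewrite /N.
have u0 : 0 <= u by rewrite divr_ge0.
have -> : r * a / (1 + (1 + r) * a * harmonic n) = N * (r * u / (1 + u + r * u)).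
  rewrite /harmonic /= -/N /u; field; rewrite !gt_eqF//=.
  by rewrite ltr_wpDr ?mulr_ge0// ltr_wpDr// ltr_wpDr.
rewrite /N expRM_natl.
have ru0 : 0 <= r * u by rewrite mulr_ge0.
have den0 : 0 < 1 + u + r * u by rewrite ltr_wpDr// ltr_pwDl.
have eu : expR (- u) <= (1 + u)^-1.
  rewrite expRN lef_pV2 ?posrE ?expR_gt0 ?expR_ge1Dx//; lra.
have base : (1 + u + r * u) / (1 + u) <= 1 + r - r * expR (- u).
  have := ler_wpM2l r0 eu.
  have -> : (1 + u + r * u) / (1 + u) = 1 + r - r * (1 + u)^-1.
    by field; rewrite gt_eqF// ltr_pwDl.
  lra.
have pos : 0 < (1 + u + r * u) / (1 + u) by rewrite divr_gt0// ltr_pwDl.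
apply: lerXn2r; rewrite ?nnegrE ?expR_ge0 ?(le_trans (ltW pos) base)//.
apply: le_trans base.
rewrite -[leLHS]invrK -expRN -[leRHS]invf_div lef_pV2 ?posrE ?expR_gt0//; last first.
  by rewrite divr_gt0// ltr_pwDl.
apply: le_trans (expR_ge1Dx _).
suff -> : (1 + u) / (1 + u + r * u) = 1 - r * u / (1 + u + r * u) by [].
by field; rewrite gt_eqF.
Unshelve. all: by end_near. Qed.

(* The approximants are combinations of the functions exp(-tX) with t in
   [t0, t0 + e], by which the vanishing propagates to the left. *)
Lemma laplace_eq0_left Phi (t0 e s : R) : bpc Phi -> 0 < e -> 0 <= s <= t0 ->
  (forall t, t0 <= t <= t0 + e -> Phi (lap t) = 0) -> Phi (lap s) = 0.
Proof.
move=> bPhi e0 /andP[s0 st] Phi0.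
(* With this [r], [exp(-s X) = exp(-t0 X) exp(r e X)]. The last factor is approximated by a
   polynomial of degree at most [n.+1] in [exp(-e X / n.+1)], so all exponents that occur lie in
   [[t0, t0 + e]]. *)
pose r := (t0 - s) / e.
have r0 : 0 <= r by rewrite divr_ge0 ?subr_ge0// ltW.
pose p n : {poly R} := ((1 + r)%:P - r%:P * 'X) ^+ n.+1.
have pE n x : (p n).[x] = (1 + r - r * x) ^+ n.+1.
  by rewrite horner_exp !hornerE.
have sp n : (size (p n) <= n.+2)%N.
  rewrite (leq_trans (size_poly_exp_leq _ _))// ltnS.
  rewrite -[X in (_ <= X)%N]mul1n leq_mul2r -subn1 leq_subLR addn1/=.
  rewrite (leq_trans (size_polyD _ _))// geq_max size_polyN.
  rewrite (leq_trans (size_polyC_leq1 _))//=.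
  rewrite (leq_trans (size_polyMleq _ _))// size_polyX.
  by rewrite addn2 /= ltnS size_polyC_leq1.
have t00 : 0 <= t0 by rewrite (le_trans s0).
pose g n x := lap t0 x * (p n).[lap (e / n.+1%:R) x].
have gE n : g n = fun x => \sum_(i < n.+2) (p n)`_i * lap (t0 + i%:R * (e / n.+1%:R)) x.
  apply/funext => x; rewrite /g (horner_coef_wide _ (sp n)) mulr_sumr.
  apply: eq_bigr => i _; rewrite mulrCA; congr *%R.
  by rewrite /lap -expRM_natl -expRD; congr expR; ring.
have tn (n : nat) (i : 'I_n.+2) : 0 <= i%:R * (e / n.+1%:R) <= e.
  rewrite mulr_ge0 ?divr_ge0// ?(ltW e0)//= mulrCA ger_pMr//.
  by rewrite ler_pdivrMr// mul1r ler_nat -ltnS.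
have bg (n : nat) (i : 'I_n.+2) : bfun (lap (t0 + i%:R * (e / n.+1%:R))).
  by apply: bfun_laplace; rewrite addr_ge0//; have /andP[] := tn n i.
apply: (@bpc_cvg_eq0 _ _ _ Phi g _ 1) => //.
- by move=> n; rewrite gE; apply: bfun_sum => i _; apply: bfunZ; exact: bg.
- move=> n x; rewrite /g pE /lap.
  have -> : - (e / n.+1%:R * X x) = - (e * X x / n.+1%:R) by rewrite mulrAC.
  have /andP[h0 h1] := @laplace_exp_le (e * X x) r n (mulr_ge0 (ltW e0) (X0 x)) r0.
  rewrite ger0_norm ?mulr_ge0 ?expR_ge0//.
  rewrite (le_trans (ler_wpM2l (expR_ge0 _) h1))// -expRD -expR0 ler_expR.
  rewrite /r mulrA divfK ?gt_eqF// addrC -mulNr -mulrDl addrAC subrr sub0r.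
  by rewrite mulNr oppr_le0 mulr_ge0.
- move=> x; rewrite /g.
  have -> : lap s x = lap t0 x * expR (r * (e * X x)).
    rewrite /lap -expRD /r mulrA divfK ?gt_eqF//; congr expR; ring.
  apply: cvgMr.
  under eq_fun do rewrite pE /lap [e / _ * _]mulrAC.
  by apply: laplace_exp_cvg => //; rewrite mulr_ge0// ltW.
- move=> n; rewrite gE bpc_sum// => [|i _]; last by apply: bfunZ; exact: bg.
  rewrite big1// => i _; rewrite bpcZ ?Phi0 ?mulr0//.
  by have /andP[? ?] := tn n i; rewrite lerDl lerD2l; apply/andP.
Qed.

End laplace.

(** * Sequences that are iid-Theta *)

Section mixture.
Context d (T : measurableType d) (R : realType).
Local Notation PT := (pprobability T R).

Lemma measurable_fun_evaluation (A : set T) : measurable A ->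
  measurable_fun [set: PT] (fun theta : PT => theta A).
Proof.
by move=> mA; exact: (measurable_kernel (kprobability (@measurable_id _ PT setT))).
Qed.

Lemma mean_cst (P : probability T R) (c : R) : \int[P]_x c = c.
Proof. by rewrite Rintegral_cst//= [X in fine X]probability_setT mulr1. Qed.

Lemma norm_mean_le (P : probability T R) (f : T -> R) (M : R) : measurable_fun setT f ->
  (forall x, `|f x| <= M) -> `|\int[P]_x f x| <= M.
Proof.
move=> mf fM; have bf : bfun f by split => //; exists M.
rewrite (le_trans (le_normr_Rintegral _ _))//; first exact: bfun_integrable.
rewrite -[leRHS](mean_cst P).
apply: le_Rintegral => //.
- apply: (bfun_integrable P (f := fun x => `|f x|)); split.
    exact: measurableT_comp.
  by exists M => x; rewrite normr_id.
- exact: (bfun_integrable P (@bfun_cst _ T R M)).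
Qed.

Lemma bfun_mean (f : T -> R) : bfun f -> bfun (fun theta : PT => \int[theta]_x f x).
Proof.
move=> bf; have [mf [M fM]] := bf.
(* Measurability of the integral against a kernel is available for nonnegative integrands, hence the
   shift by the bound [M]. *)
have intE (theta : PT) : \int[theta]_x f x = \int[theta]_x (f x + M) - M.
  rewrite (bpcD (bpc_integral theta))//; last exact: bfun_cst.
  by rewrite mean_cst addrK.
have fM0 x : 0 <= f x + M.
  by have := fM x; rewrite ler_norml => /andP[+ _]; rewrite -subr_ge0 opprK.
split.
  under eq_fun do rewrite intE.
  apply: measurable_funB => //.
  apply: (@measurableT_comp _ _ _ _ _ _ fine); first exact: fine_measurable.
  apply: (@measurable_fun_integral_kernel _ _ PT T R (fun theta => theta) _
    (fun x => (f x + M)%:E)).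
  - exact: measurable_fun_evaluation.
  - by move=> x; rewrite lee_fin.
  - by apply/measurable_EFinP; exact: measurable_funD.
by exists M => theta; exact: norm_mean_le.
Qed.

(** If [Phi] integrates against a mixing measure, the new functional integrates against the averaged
    measure on [T]. *)
Lemma bpc_mean (Phi : (PT -> R) -> R) : bpc Phi ->
  bpc (fun f : T -> R => Phi (fun theta => \int[theta]_x f x)).
Proof.
move=> bPhi; split=> [c f g bf bg|f_ f M bf fM ff].
  rewrite -(bPhi.1 c)//; [|exact: bfun_mean|exact: bfun_mean].
  by congr Phi; apply/funext => theta; rewrite (bpc_integral theta).1.
apply: (bPhi.2 _ _ M) => [n|n theta|theta]; first exact: bfun_mean.
- by apply: norm_mean_le; [have [] := bf n|exact: fM].
- exact: (bpc_integral theta).2 bf fM ff.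
Qed.

End mixture.

Lemma mean_indic d (T : measurableType d) (R : realType) (P : probability T R)
  (A : set T) : measurable A -> \int[P]_x \1_A x = fine (P A).
Proof. by move=> mA; rewrite /Rintegral integral_indic// setIT. Qed.

Lemma mean_ext d (T : measurableType d) (R : realType) (P : probability T R)
    (A : set T) (f g : T -> R) :
  measurable A -> P A = 1%E -> bfun f -> bfun g -> (forall x, A x -> f x = g x) ->
  \int[P]_x f x = \int[P]_x g x.
Proof.
move=> mA PA [mf _] [mg _] fg; congr fine; apply: ae_eq_integral => //.
- exact/measurable_EFinP.
- exact/measurable_EFinP.
- exists (~` A); split; first exact: measurableC.
    by rewrite [LHS]probability_setC// PA subee.
  by move=> x /= nfg Ax; apply: nfg => _; rewrite fg.
Qed.

Section iid_moments.
Context (R : realType) (Th : probability (probR R) R).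
Context d (T : measurableType d) (P : probability T R) (X : nat -> {RV P >-> R}).
Hypothesis iidX : iid Th X.

Lemma measurable_coordinate (i : nat) :
  measurable_fun [set: seqR R] (fun x : seqR R => x i).
Proof.
apply: (measurability _ (RGenOInfty.measurableE R)) => _ [_ [a ->] <-].
rewrite setTI; apply: sub_sigma_algebra => /=.
have := @open_comp (prod_topology (fun _ : nat => R)) R (@proj nat (fun=> R) i)
  `]a, +oo[%classic.
apply; last exact: interval_open.
by move=> x _; exact: proj_continuous.
Qed.

Lemma measurable_rectangle (A : nat -> set R) n : (forall i, measurable (A i)) ->
  measurable ([set x | forall i, (i < n)%N -> A i (x i)] : set (seqR R)).
Proof.
move=> mA.
rewrite (_ : [set _ | _] = \bigcap_i [set x : seqR R | (i < n)%N -> A i (x i)]); last first.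
  by apply/seteqP; split => x Ax; [move=> i _; exact: Ax|move=> i; exact: Ax].
apply: bigcapT_measurable => i; case: (ltnP i n) => ni.
  rewrite (_ : [set _ | _] = (fun x : seqR R => x i) @^-1` A i).
    by rewrite -[X in measurable X]setTI; exact: measurable_coordinate.
  by apply/seteqP; split => x /=; [exact|].
rewrite (_ : [set _ | _] = setT); first exact: measurableT.
by apply/seteqP; split => x.
Qed.

Lemma prod_indic n (A : nat -> set R) (x : nat -> R) :
  \prod_(i < n) \1_(A i) (x i) = (`[< forall i, (i < n)%N -> A i (x i) >])%:R :> R.
Proof.
have [At|/existsNP[i /not_implyP[ni nA]]] := asboolP.
  by rewrite big1// => i _; rewrite indicE mem_set//; exact: At.
by rewrite (bigD1 (Ordinal ni))//= indicE memNset// mul0r.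
Qed.

Lemma measurable_joint (A : nat -> set R) n : (forall i, measurable (A i)) ->
  measurable [set t | forall i, (i < n)%N -> A i (X i t)].
Proof.
move=> mA.
rewrite (_ : [set _ | _] = \bigcap_i [set t | (i < n)%N -> A i (X i t)]); last first.
  by apply/seteqP; split => x Ax; [move=> i _; exact: Ax|move=> i; exact: Ax].
apply: bigcapT_measurable => i; case: (ltnP i n) => ni.
  rewrite (_ : [set _ | _] = X i @^-1` A i); first exact: measurable_funPTI.
  by apply/seteqP; split => x /=; [exact|].
rewrite (_ : [set _ | _] = setT); first exact: measurableT.
by apply/seteqP; split => x.
Qed.

(** The definition of [iid] is applied to a rectangle, where the product measure is given by a
    finite product. *)
Lemma iid_mean_indic n (A : nat -> set R) : (forall i, measurable (A i)) ->
  \int[P]_t (\prod_(i < n) \1_(A i) (X i t)) =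
  \int[Th]_theta (\prod_(i < n) \int[theta]_x \1_(A i) x).
Proof.
move=> mA; have [prodN prodNE PE] := iidX.
have mrect := measurable_rectangle n mA.
rewrite (_ : (fun t => _) = \1_[set t | forall i, (i < n)%N -> A i (X i t)]); last first.
  by apply/funext => t; exact: (prod_indic n A (X ^~ t)).
rewrite mean_indic; last exact: measurable_joint.
rewrite (PE _ mrect); congr fine; apply: eq_integral => theta _.
rewrite (prodNE theta)// -prodEFin; apply: eq_bigr => i _.
by rewrite mean_indic// fineK// fin_num_measure.
Qed.

(* The indicators are replaced by the functions [f i] one coordinate at a time. *)
Lemma iid_mean_prod n (f : nat -> R -> R) : (forall i, bfun (f i)) ->
  \int[P]_t (\prod_(i < n) f i (X i t)) =
  \int[Th]_theta (\prod_(i < n) \int[theta]_x f i x).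
Proof.
suff H m g : (m <= n)%N -> (forall i, bfun (g i)) ->
    (forall i, (m <= i)%N -> exists2 A, measurable A & g i = \1_A) ->
  \int[P]_t (\prod_(i < n) g i (X i t)) =
  \int[Th]_theta (\prod_(i < n) \int[theta]_x g i x).
  (* The claim [H] wants indicators from index [m] on. Beyond [n] the functions do not enter the
     products, so the indicator of the whole line may stand there. *)
  move=> bf; pose g i := if (i < n)%N then f i else \1_setT.
  have gL : (fun t => \prod_(i < n) g i (X i t)) = (fun t => \prod_(i < n) f i (X i t)).
    by apply/funext => t; apply: eq_bigr => i _; rewrite /g ltn_ord.
  have gR : (fun theta : probR R => \prod_(i < n) \int[theta]_x g i x) =
      (fun theta => \prod_(i < n) \int[theta]_x f i x).
    by apply/funext => t; apply: eq_bigr => i _; rewrite /g ltn_ord.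
  rewrite -gL -gR; apply: (H n) => // [i|i ni]; rewrite /g.
    by case: ifP => // _; exact: bfun_indic.
  by rewrite ltnNge ni /=; exists setT.
elim: m g => [|m ih] g mn bg gA.
  have /choice[A AE] : forall i, exists A : set R, measurable A /\ g i = \1_A.
    by move=> i; have [A mA gE] := gA i (leq0n i); exists A.
  have -> : g = fun i => \1_(A i) by apply/funext => i; exact: (AE i).2.
  by apply: iid_mean_indic => i; exact: (AE i).1.
pose m' := Ordinal mn.
pose W t := \prod_(i < n | i != m') g i (X i t).
pose V (theta : probR R) := \prod_(i < n | i != m') \int[theta]_x g i x.
have bW : bfun W.
  by apply: bfun_prod => i _; apply: (bfun_comp _ (bg i)); exact: measurable_funPT.
have bV : bfun V by apply: bfun_prod => i _; exact: bfun_mean.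
(* Both sides are continuous functionals of the function at coordinate [m] alone, with the other
   coordinates as weights [W] and [V]. Their difference therefore needs checking only on indicators,
   where the induction hypothesis applies. *)
pose Psi (phi : R -> R) := 1 * \int[P]_t (W t * phi (X m t))
  + (-1) * \int[Th]_theta (V theta * \int[theta]_x phi x).
have bPsi : bpc Psi.
  apply: (@bpc_lincomb _ _ _ (fun phi => \int[P]_t (W t * phi (X m t)))).
    have mX : measurable_fun setT (X m) by exact: measurable_funPT.
    exact: (bpc_comp mX (bpc_weight (bpc_integral P) bW)).
  exact: (bpc_mean (bpc_weight (bpc_integral Th) bV)).
have PsiE h : (forall i, i != m -> h i = g i) -> Psi (h m) =
    \int[P]_t (\prod_(i < n) h i (X i t)) -
    \int[Th]_theta (\prod_(i < n) \int[theta]_x h i x).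
  move=> hg; rewrite /Psi mul1r mulN1r; congr (_ - _).
    apply: eq_Rintegral => t _; rewrite [RHS](bigD1 m')//= mulrC; congr *%R.
    by apply: eq_bigr => i im; rewrite hg.
  apply: eq_Rintegral => theta _; rewrite [RHS](bigD1 m')//= mulrC; congr *%R.
  by apply: eq_bigr => i im; rewrite hg.
apply/eqP; rewrite -subr_eq0 -PsiE//; apply/eqP.
apply: bpc_indic_eq0 => // A mA.
pose h i := if i == m then \1_A else g i.
have hm : h m = \1_A by rewrite /h eqxx.
rewrite -hm PsiE => [|i /negPf im]; last by rewrite /h im.
apply/eqP; rewrite subr_eq0; apply/eqP; apply: ih; first exact: ltnW.
- by move=> i; rewrite /h; case: ifP => // _; exact: bfun_indic.
- move=> i mi; rewrite /h; case: ifPn => [_|im]; first by exists A.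
  by apply: gA; rewrite ltn_neqAle eq_sym im.
Qed.

End iid_moments.

Section laplace_kernel.
Context (R : realType).
Implicit Types (t x : R).

(* Truncated at 0 so as to be bounded; the measures of interest live on [0, +oo). *)
Definition laplace_kernel t x := expR (- (t * Num.max x 0)).

Lemma measurable_max0 : measurable_fun [set: R] (fun x : R => Num.max x 0).
Proof. exact: measurable_maxr. Qed.

Lemma max0_ge0 x : 0 <= Num.max x 0.
Proof. by rewrite le_max lexx orbT. Qed.

Lemma bfun_laplace_kernel t : 0 <= t -> bfun (laplace_kernel t).
Proof. exact: (bfun_laplace measurable_max0 max0_ge0). Qed.

Lemma laplace_kernel_sum t n (x : nat -> R) : (forall i, (i < n)%N -> 0 <= x i) ->
  laplace_kernel t (\sum_(i < n) x i) = \prod_(i < n) laplace_kernel t (x i).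
Proof.
move=> x0; rewrite /laplace_kernel -expR_sum; congr expR.
rewrite max_l ?sumr_ge0// => [|i _]; last exact: x0.
rewrite mulr_sumr -sumrN; apply: eq_bigr => i _.
by rewrite max_l//; exact: x0.
Qed.

End laplace_kernel.

Section laplace_of_sums.
Context (R : realType) (L : set (probR R)).
Hypotheses (mL : measurable L)
  (L0 : forall theta, L theta -> theta `[0, +oo[%classic = 1%E).

Section one_sequence.
Context (Th : probability (probR R) R) (ThL : Th L = 1%E)
  d (T : measurableType d) (P : probability T R) (X : nat -> {RV P >-> R})
  (iidX : iid Th X).

(** Almost every [theta] lives on [[0, +oo[], so the mean of the product of indicators is the mean
    of 1. This makes the truncation in [laplace_kernel] harmless for the sums. *)
Lemma iid_ge0 n : P [set t | forall i, (i < n)%N -> 0 <= X i t] = 1%E.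
Proof.
pose A (i : nat) : set R := `[0, +oo[%classic.
have mA i : measurable (A i) by exact: measurable_itv.
have mj := measurable_joint X n mA.
rewrite (_ : [set _ | _] = [set t | forall i, (i < n)%N -> A i (X i t)]); last first.
  by apply/seteqP; split=> t Xt i ni; have := Xt i ni; rewrite /A /= in_itv/= andbT.
rewrite -[LHS]fineK ?fin_num_measure//; congr EFin.
rewrite -mean_indic//.
have -> : \1_[set t | forall i, (i < n)%N -> A i (X i t)] =
    (fun t => \prod_(i < n) \1_(A i) (X i t)) :> (T -> R).
  by apply/funext => t; rewrite [RHS](prod_indic n A (X ^~ t)).
rewrite (iid_mean_indic iidX)// -[RHS](mean_cst Th 1).
apply: (mean_ext mL ThL); [|exact: bfun_cst|].
  by apply: bfun_prod => i _; apply: bfun_mean; exact: bfun_indic.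
by move=> theta Lt; rewrite big1// => i _; rewrite mean_indic// L0.
Qed.

Lemma iid_laplace t n : 0 <= t ->
  \int[P]_w laplace_kernel t ((\sum_(j < n) X j) w) =
  \int[Th]_theta ((\int[theta]_x laplace_kernel t x) ^+ n).
Proof.
move=> t0; have bt := bfun_laplace_kernel t0.
have mA : measurable [set w | forall i, (i < n)%N -> 0 <= X i w].
  rewrite (_ : [set _ | _] =
      [set w | forall i, (i < n)%N -> `[0, +oo[%classic (X i w)]).
    by apply: (@measurable_joint _ _ _ _ X (fun=> _)) => _; exact: measurable_itv.
  by apply/seteqP; split=> w Xw i ni; have := Xw i ni; rewrite /= in_itv/= andbT.
have -> : \int[P]_w laplace_kernel t ((\sum_(j < n) X j) w) =
    \int[P]_w (\prod_(j < n) laplace_kernel t (X j w)).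
  apply: (mean_ext mA (iid_ge0 n)).
  - by apply: (bfun_comp _ bt); exact: measurable_funPT.
  - by apply: bfun_prod => j _; apply: (bfun_comp _ bt); exact: measurable_funPT.
  - by move=> w Xw; rewrite mfun_sum (laplace_kernel_sum t Xw).
rewrite (iid_mean_prod iidX n (fun=> bt)).
by apply: eq_Rintegral => theta _; rewrite prodr_const card_ord.
Qed.

End one_sequence.

Lemma iid_same_moments (Th1 Th2 : probability (probR R) R) (d1 d2 : measure_display)
    (T1 : measurableType d1) (T2 : measurableType d2)
    (P1 : probability T1 R) (P2 : probability T2 R)
    (X : nat -> {RV P1 >-> R}) (Y : nat -> {RV P2 >-> R}) :
  Th1 L = 1%E -> Th2 L = 1%E -> iid Th1 X -> iid Th2 Y ->
  (forall n : nat, (0 < n)%N -> forall B : set R, measurable B ->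
     distribution P1 (\sum_(j < n) X j) B = distribution P2 (\sum_(j < n) Y j) B) ->
  forall t n, 0 <= t ->
    \int[Th1]_theta ((\int[theta]_x laplace_kernel t x) ^+ n) =
    \int[Th2]_theta ((\int[theta]_x laplace_kernel t x) ^+ n).
Proof.
move=> Th1L Th2L iidX iidY XY t [|n] t0.
  (* The hypothesis on sums starts at one summand; the moment of order 0 is 1 on both sides. *)
  by under eq_Rintegral do rewrite expr0; rewrite mean_cst;
    under eq_Rintegral do rewrite expr0; rewrite mean_cst.
rewrite -(iid_laplace Th1L iidX)// -(iid_laplace Th2L iidY)//.
pose SX := \sum_(j < n.+1) X j; pose SY := \sum_(j < n.+1) Y j.
have mSX : measurable_fun setT SX by exact: measurable_funPT.
have mSY : measurable_fun setT SY by exact: measurable_funPT.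
pose Psi (phi : R -> R) := 1 * \int[P1]_w phi (SX w) + (-1) * \int[P2]_w phi (SY w).
have bPsi : bpc Psi.
  apply: bpc_lincomb.
    exact: (bpc_comp mSX (bpc_integral P1)).
  exact: (bpc_comp mSY (bpc_integral P2)).
have : Psi (laplace_kernel t) = 0.
  apply: bpc_indic_eq0 => //; last exact: bfun_laplace_kernel.
  move=> A mA; rewrite /Psi mul1r mulN1r.
  rewrite (mean_indic P1 (A := SX @^-1` A)); last exact: measurable_funPTI.
  rewrite (mean_indic P2 (A := SY @^-1` A)); last exact: measurable_funPTI.
  by have := XY n.+1 isT A mA; rewrite /distribution /pushforward => ->; rewrite subrr.
by rewrite /Psi mul1r mulN1r => /eqP; rewrite subr_eq0 => /eqP.
Qed.

End laplace_of_sums.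

(** * Mixed moments *)

(** Approaching from the right keeps the arguments nonnegative, so that the kernels are bounded by
    1. *)
Lemma bpc_laplace_cvg (R : realType) (Phi : (R -> R) -> R) (t0 : R) : bpc Phi -> 0 <= t0 ->
  Phi (laplace_kernel t) @[t --> t0^'+] --> Phi (laplace_kernel t0).
Proof.
move=> bPhi t00; apply/cvg_at_rightP => u [u0 ut].
have un0 n : 0 <= u n by rewrite (le_trans t00)// ltW.
apply: (bPhi.2 (fun n => laplace_kernel (u n)) _ 1).
- by move=> n; exact: bfun_laplace_kernel.
- move=> n x; have /andP[? ?] := laplace_ge0_le1 (@max0_ge0 R) x (un0 n).
  by rewrite ger0_norm.
- move=> x; apply: continuous_cvg; first exact: continuous_expR.
  by apply: cvgN; apply: cvgMl.
Qed.

(* If [c j] were the first nonzero coefficient, the form would be [a ^+ j] times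
   a function with nonzero limit [c j] at [t0], so [a] would vanish to the right
   of [t0]. *)
Lemma binary_form_eq0 (R : realType) (a b : R -> R) (t0 : R) (n : nat) (c : nat -> R) :
  a x @[x --> t0^'+] --> 0 -> b x @[x --> t0^'+] --> (1 : R) ->
  (forall e, 0 < e -> exists t, [/\ t0 < t, t < t0 + e & a t != 0]) ->
  (forall t, t0 < t -> \sum_(j < n.+1) c j * (a t ^+ j * b t ^+ (n - j)) = 0) ->
  forall j, (j <= n)%N -> c j = 0.
Proof.
move=> ca cb an0 S0 j; have [k] := ubnP j; elim: k j => // k ih j jk jn.
apply/eqP; apply: contrapT => /negP cj0.
pose Q t := \sum_(i < n.+1 | (j <= i)%N) c i * (a t ^+ (i - j) * b t ^+ (n - i)).
have SQ t : t0 < t -> a t ^+ j * Q t = 0.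
  move=> tt; rewrite -[RHS](S0 t)// /Q mulr_sumr.
  rewrite [RHS](bigID (fun i : 'I_n.+1 => (j <= i)%N))/= [X in _ = _ + X]big1.
    rewrite addr0; apply: eq_bigr => i ji.
    by rewrite mulrCA; congr *%R; rewrite mulrA -exprD subnKC.
  by move=> i; rewrite -ltnNge => ij; rewrite ih ?mul0r// ?(leq_trans ij)//;
    rewrite ltnW// (leq_trans ij).
have cQ : Q t @[t --> t0^'+] --> c j.
  have -> : c j = \sum_(i < n.+1 | (j <= i)%N) c i * (0 ^+ (i - j) * 1 ^+ (n - i)).
    rewrite (bigD1 (Ordinal (jn : (j < n.+1)%N)))//= subnn expr0 expr1n !mulr1.
    rewrite big1 ?addr0// => i /andP[ji ij].
    have ji' : (j < i)%N.
      by rewrite ltn_neqAle ji andbT; apply: contraNneq ij => jE; apply/eqP/val_inj.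
    by rewrite expr0n subn_eq0 leqNgt ji' mul0r mulr0.
  apply: cvg_big => [|i ji]; first exact: add_continuous.
  apply: cvgMr; apply: cvgM.
    exact: (continuous_cvg _ (@exprn_continuous R (i - j) _) ca).
  exact: (continuous_cvg _ (@exprn_continuous R (n - i) _) cb).
have : \forall t \near t0^'+, Q t != 0.
  exact: (cvgr_neq0 _ cQ).
move=> [e /= e0 Qe].
have [t [t0t te at0]] := an0 _ e0.
have := SQ t t0t; move/eqP; rewrite mulf_eq0 expf_eq0 (negPf at0) andbF/=.
apply/negP; apply: Qe => //=.
by rewrite ltr0_norm ?subr_lt0// opprB ltrBlDl.
Qed.

Section mixed_moments.
Context d (Z : measurableType d) (R : realType) (Phi : (Z -> R) -> R) (L : set Z).
Hypotheses (bPhi : bpc Phi)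
  (PhiL : forall f g, bfun f -> bfun g -> (forall z, L z -> f z = g z) -> Phi f = Phi g).

(** Expanding the power of order [j + k] of [U t] on [L] by the binomial theorem gives a binary form
    in [(a t, b t)] that vanishes for [t > t0]. Its coefficients are the mixed moments times nonzero
    binomial coefficients. *)
Lemma mixed_moments_eq0 (U : R -> Z -> R) (u v : Z -> R) (a b : R -> R) (t0 : R) :
  bfun u -> bfun v -> (forall t, t0 < t -> bfun (U t)) ->
  (forall t z, t0 < t -> L z -> U t z = a t * u z + b t * v z) ->
  (forall t n, t0 < t -> Phi (fun z => U t z ^+ n) = 0) ->
  a x @[x --> t0^'+] --> 0 -> b x @[x --> t0^'+] --> (1 : R) ->
  (forall e, 0 < e -> exists t, [/\ t0 < t, t < t0 + e & a t != 0]) ->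
  forall j k, Phi (fun z => u z ^+ j * v z ^+ k) = 0.
Proof.
move=> bu bv bU UL PhiU ca cb an0 j k.
pose n := (j + k)%N.
have buv i l : bfun (fun z => u z ^+ i * v z ^+ l) by apply: bfunM; exact: bfunX.
pose c i := 'C(n, i)%:R * Phi (fun z => u z ^+ i * v z ^+ (n - i)).
suff : c j = 0.
  move/eqP; rewrite /c mulf_eq0 pnatr_eq0 -leqn0 leqNgt bin_gt0 leq_addr/=.
  by rewrite /n addKn => /eqP.
apply: (@binary_form_eq0 _ a b t0 n) => //; last exact: leq_addr.
move=> t t0t; rewrite -[RHS](PhiU t n t0t).
rewrite (_ : Phi (fun z => U t z ^+ n) = Phi (fun z => \sum_(i < n.+1)
    ('C(n, i)%:R * (a t ^+ i * b t ^+ (n - i))) * (u z ^+ i * v z ^+ (n - i)))).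
  rewrite bpc_sum// => [|i _]; last exact: bfunZ.
  by apply: eq_bigr => i _; rewrite bpcZ// /c; ring.
apply: PhiL; first by apply: bfunX; exact: bU.
  by apply: bfun_sum => i _; exact: bfunZ.
move=> z Lz; rewrite UL// addrC exprDn; apply: eq_bigr => i _.
by rewrite -mulr_natl !exprMn; ring.
Qed.

(* The class of weights [W] below is stable under multiplication by [X z] for
   each of the functions [X], hence by the indicators of their level sets. *)
Lemma moments_determine (G : set (Z -> R)) (u v : Z -> R) :
  bfun u -> bfun v ->
  (forall j k, Phi (fun z => u z ^+ j * v z ^+ k) = 0) ->
  (forall X, G X -> [/\ measurable_fun setT X, forall z, 0 <= X z <= 1 &
    exists c a b, forall z, L z -> X z = c + a * u z + b * v z]) ->
  forall A, <<s [set X @^-1` C | X in G & C in measurable] >> A -> Phi \1_A = 0.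
Proof.
move=> bu bv Phiuv GX.
have buv j k : bfun (fun z => u z ^+ j * v z ^+ k) by apply: bfunM; exact: bfunX.
pose cls := [set W : Z -> R | bfun W /\
  forall j k, Phi (fun z => W z * (u z ^+ j * v z ^+ k)) = 0].
have clsX X W : G X -> cls W -> cls (fun z => W z * X z).
  move=> /GX[mX X01 [c [a [b XE]]]] [bW W0].
  have bX : bfun X by exact: bfun_ge0_le1.
  split => [|j k]; first exact: bfunM.
  have bWuv i l : bfun (fun z => W z * (u z ^+ i * v z ^+ l)) by exact: bfunM.
  rewrite (PhiL (g := fun z => (c * (W z * (u z ^+ j * v z ^+ k)) +
      a * (W z * (u z ^+ j.+1 * v z ^+ k))) + b * (W z * (u z ^+ j * v z ^+ k.+1)))).
  - rewrite !(bpcD bPhi)//; do ?[exact: bfunZ|apply: bfunD; exact: bfunZ].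
    by rewrite !(bpcZ _ bPhi)// !W0 !mulr0 !addr0.
  - by apply: bfunM => //; exact: bfunM.
  - by do 2?[apply: bfunD]; exact: bfunZ.
  - by move=> z Lz; rewrite XE// !exprS; ring.
have clsXn X W n : G X -> cls W -> cls (fun z => W z * X z ^+ n).
  move=> GXX cW; elim: n => [|n ih].
    by rewrite (_ : (fun _ => _) = W)//; apply/funext => z; rewrite expr0 mulr1.
  rewrite (_ : (fun _ => _) = fun z => W z * X z ^+ n * X z); first exact: clsX.
  by apply/funext => z; rewrite exprSr mulrA.
have clsC X W C : G X -> measurable C -> cls W -> cls (fun z => W z * \1_(X @^-1` C) z).
  move=> GXX mC cW; have [mX X01 _] := GX _ GXX; have [bW _] := cW.
  have mXC : measurable (X @^-1` C) by rewrite -[X in measurable X]setTI; exact: mX.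
  split => [|j k]; first by apply: bfunM => //; exact: bfun_indic.
  have bWuv : bfun (fun z => W z * (u z ^+ j * v z ^+ k)) by exact: bfunM.
  (* The moment theorem is applied to the functional with weight [W u^j v^k]; its moments in [X]
     vanish because [W X^n] stays in the class. *)
  have := hausdorff_moment (bpc_weight bPhi bWuv) mX X01 _ mC.
  rewrite (_ : (fun z => _ * (u z ^+ j * _)) = (fun z =>
    W z * (u z ^+ j * v z ^+ k) * \1_(X @^-1` C) z)); last first.
    by apply/funext => z; ring.
  apply => n; have [_ /(_ j k) <-] := clsXn X W n GXX cW.
  by congr Phi; apply/funext => z; ring.
(* Quantifying over all weights makes [D] stable under intersection: one indicator is absorbed into
   the weight before the next is multiplied in. *)
pose D := [set A : set Z | measurable A /\
  forall W, cls W -> cls (fun z => W z * \1_A z)].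
have cls1 : cls (fun=> 1).
  split => [|j k]; first exact: bfun_cst.
  by under eq_fun do rewrite mul1r; exact: Phiuv.
have bPhiW W j k : cls W -> bpc (fun f => Phi (fun z => W z * (u z ^+ j * v z ^+ k) * f z)).
  by move=> [bW _]; apply: bpc_weight => //; exact: bfunM.
have DE W A : cls W -> measurable A -> cls (fun z => W z * \1_A z) <->
    forall j k, Phi (fun z => W z * (u z ^+ j * v z ^+ k) * \1_A z) = 0.
  move=> [bW _] mA; split => [[_ h] j k|h].
    by rewrite -[RHS](h j k); congr Phi; apply/funext => z; ring.
  split => [|j k]; first by apply: bfunM => //; exact: bfun_indic.
  by rewrite -[RHS](h j k); congr Phi; apply/funext => z; ring.
have dD : dynkin D.
  split => [|A [mA DA]|F tF DF].
  - split => // W; rewrite (_ : (fun z => W z * _) = W)//.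
    by apply/funext => z; rewrite indicT mulr1.
  - split => [|W cW]; first exact: measurableC.
    apply/DE => //; first exact: measurableC.
    move=> j k.
    have W1 : Phi (fun z => W z * (u z ^+ j * v z ^+ k) * 1) = 0.
      by under eq_fun do rewrite mulr1; have [_] := cW; exact.
    have [_ + _] := bpc_dynkin (bPhiW W j k cW) W1.
    by move=> /(_ A)[]//=; split => //; exact: (DE W A cW mA).1 (DA W cW) j k.
  - have mF n : measurable (F n) by have [] := DF n.
    split => [|W cW]; first exact: bigcup_measurable.
    apply/DE => //; first exact: bigcup_measurable.
    move=> j k.
    have W1 : Phi (fun z => W z * (u z ^+ j * v z ^+ k) * 1) = 0.
      by under eq_fun do rewrite mulr1; have [_] := cW; exact.
    have [_ _ +] := bpc_dynkin (bPhiW W j k cW) W1.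
    move=> /(_ F tF)[]//= n; split => //; have [_ DFn] := DF n.
    exact: (DE W (F n) cW (mF n)).1 (DFn W cW) j k.
have ID : setI_closed D.
  move=> A B [mA DA] [mB DB]; split => [|W cW]; first exact: measurableI.
  rewrite (_ : (fun z => W z * _) = (fun z => W z * \1_A z * \1_B z)).
    by apply: DB; exact: DA.
  by apply/funext => z; rewrite indicI mulrA.
move=> A sA; have : D A.
  move: A sA; apply: smallest_sub; first exact: dynkin_setI_sigma_algebra.
  move=> _ [X GXX [C mC <-]]; have [mX _ _] := GX _ GXX.
  split => [|W cW]; last exact: clsC.
  by rewrite -[X in measurable X]setTI; exact: mX.
move=> [mA /(_ _ cls1)[_ /(_ 0%N 0%N) <-]].
by congr Phi; apply/funext => z; rewrite !expr0 !mulr1 mul1r.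
Qed.

End mixed_moments.

(** * Convex hulls of three measures *)

(** Links the truncated variable, to which the uniqueness of Laplace transforms applies, with the
    Borel sets themselves. *)
Lemma mean_max0 (R : realType) (mu : probR R) (C : set R) :
  mu `[0, +oo[%classic = 1%E -> measurable C ->
  \int[mu]_x \1_C x = \int[mu]_x \1_((fun x : R => Num.max x 0) @^-1` C) x.
Proof.
move=> mu0 mC; apply: (mean_ext _ mu0); first exact: measurable_itv.
- exact: bfun_indic.
- apply: bfun_indic; rewrite -[X in measurable X]setTI.
  exact: measurable_max0.
- move=> x; rewrite /= in_itv/= andbT => x0.
  by rewrite indic_preimage /= max_l.
Qed.

(** Cramer's rule: the vector x is expanded in the independent vectors y and z, then paired with
    [(a1, a2)]. *)
Lemma cramer2 (F : fieldType) (a1 a2 x1 x2 y1 y2 z1 z2 d : F) :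
  d = y1 * z2 - y2 * z1 -> d != 0 ->
  a1 * x1 + a2 * x2 =
  (z2 / d * x1 + - z1 / d * x2) * (a1 * y1 + a2 * y2) +
  (- y2 / d * x1 + y1 / d * x2) * (a1 * z1 + a2 * z2).
Proof. by move=> -> dn0; field. Qed.

(** Coordinates of the basis vectors themselves; they give the values of the coefficient functions
    at the two base points. *)
Lemma cramer2_unit (F : fieldType) (y1 y2 z1 z2 d : F) :
  d = y1 * z2 - y2 * z1 -> d != 0 ->
  [/\ z2 / d * y1 + - z1 / d * y2 = 1, z2 / d * z1 + - z1 / d * z2 = 0 &
      - y2 / d * z1 + y1 / d * z2 = 1].
Proof. by move=> -> dn0; split; field. Qed.

Section convex_hull.
Context (R : realType) (mu1 mu2 mu3 : probR R).
Hypotheses (mu1_ge0 : mu1 `[0, +oo[%classic = 1%E)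
  (mu2_ge0 : mu2 `[0, +oo[%classic = 1%E) (mu3_ge0 : mu3 `[0, +oo[%classic = 1%E).
Local Notation L := (convex_hull3 mu1 mu2 mu3).
Local Notation lk := (@laplace_kernel R).

(** The integral against the signed measure [mu - nu], written in the shape that [bpc_lincomb]
    handles. *)
Definition mean_diff (mu nu : probR R) (f : R -> R) :=
  1 * \int[mu]_x f x + (-1) * \int[nu]_x f x.
Local Notation D1 := (mean_diff mu1 mu3).
Local Notation D2 := (mean_diff mu2 mu3).

Lemma bpc_mean_diff mu nu : bpc (mean_diff mu nu).
Proof. by apply: bpc_lincomb; exact: bpc_integral. Qed.
Let bD1 := bpc_mean_diff mu1 mu3.
Let bD2 := bpc_mean_diff mu2 mu3.

(** The identity on measurable sets extends to bounded functions through [bpc_indic_eq0];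
    eliminating the third coefficient makes the integral affine in [(a1, a2)]. *)
Lemma mean_hullP (theta : probR R) : L theta -> exists a1 a2,
  [/\ 0 <= a1, 0 <= a2, a1 + a2 <= 1 & forall f, bfun f ->
  \int[theta]_x f x = \int[mu3]_x f x + a1 * D1 f + a2 * D2 f].
Proof.
move=> [a1 [a2 [a3 [a123 a10 a20 a30 thE]]]].
exists a1, a2; split => //; first by rewrite -a123 lerDl.
move=> f bf; rewrite /mean_diff.
have -> : \int[theta]_x f x =
    1 * (a1 * \int[mu1]_x f x + a2 * \int[mu2]_x f x) + a3 * \int[mu3]_x f x.
  pose Psi f := 1 * \int[theta]_x f x + (-1) *
    (1 * (a1 * \int[mu1]_x f x + a2 * \int[mu2]_x f x) + a3 * \int[mu3]_x f x).
  have bPsi : bpc Psi.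
    apply: bpc_lincomb; first exact: bpc_integral.
    apply: bpc_lincomb; last exact: bpc_integral.
    by apply: bpc_lincomb; exact: bpc_integral.
  apply/eqP; rewrite -subr_eq0; apply/eqP.
  suff : Psi f = 0 by rewrite /Psi mul1r mulN1r.
  apply: bpc_indic_eq0 => // A mA.
  rewrite /Psi !mean_indic// thE//.
  rewrite !fineD ?fin_numM ?fin_num_measure ?fin_numD ?fin_numM ?fin_num_measure//.
  by rewrite !fineM ?fin_num_measure//=; ring.
have -> : a3 = 1 - a1 - a2 by rewrite -a123; ring.
by ring.
Qed.

Lemma hull_ge0 (theta : probR R) : L theta -> theta `[0, +oo[%classic = 1%E.
Proof.
move=> [a1 [a2 [a3 [a123 _ _ _ thE]]]].
rewrite thE; last exact: measurable_itv.
by rewrite [mu1 _]mu1_ge0 [mu2 _]mu2_ge0 [mu3 _]mu3_ge0 !mule1 -!EFinD a123.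
Qed.

Lemma mean_diff_max0 (mu : probR R) (C : set R) :
  mu `[0, +oo[%classic = 1%E -> measurable C ->
  mean_diff mu mu3 \1_((fun x : R => Num.max x 0) @^-1` C) = mean_diff mu mu3 \1_C.
Proof. by move=> mu0 mC; rewrite /mean_diff -!mean_max0. Qed.

(** A linear relation between the Laplace transforms is one between the signed measures, by
    uniqueness. *)
Lemma lincomb_laplace_eq0 (a b : R) :
  (forall t, 0 <= t -> a * D1 (lk t) + b * D2 (lk t) = 0) ->
  forall C, measurable C -> a * D1 \1_C + b * D2 \1_C = 0.
Proof.
move=> ab0 C mC; rewrite -(mean_diff_max0 mu1_ge0)// -(mean_diff_max0 mu2_ge0)//.
apply: (laplace_unique (@measurable_max0 R) (@max0_ge0 R) (bpc_lincomb a b bD1 bD2)) => //.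
by move=> k; exact: ab0.
Qed.

Section functionals.
Context (Phi : (probR R -> R) -> R).
Hypotheses (bPhi : bpc Phi)
  (PhiL : forall f g, bfun f -> bfun g -> (forall theta, L theta -> f theta = g theta) ->
    Phi f = Phi g)
  (Phi_laplace : forall t n, 0 <= t ->
    Phi (fun theta => (\int[theta]_x lk t x) ^+ n) = 0).

Let U t (theta : probR R) := \int[theta]_x lk t x - \int[mu3]_x lk t x.

Let bU t : 0 <= t -> bfun (U t).
Proof.
move=> t0; apply: bfunB; last exact: bfun_cst.
by apply: bfun_mean; exact: bfun_laplace_kernel.
Qed.

Let PhiU t n : 0 <= t -> Phi (fun theta => U t theta ^+ n) = 0.
Proof.
move=> t0.
rewrite (_ : (fun theta => U t theta ^+ n) = fun theta : probR R =>
    (('X - (\int[mu3]_x lk t x)%:P) ^+ n).[\int[theta]_x lk t x]); last first.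
  by apply/funext => theta; rewrite horner_exp !hornerE.
apply: bpc_horner => //.
- by apply: bfun_mean; exact: bfun_laplace_kernel.
- by move=> k; exact: Phi_laplace.
Qed.

Let UE (theta : probR R) a1 a2 t :
  (forall f, bfun f ->
    \int[theta]_x f x = \int[mu3]_x f x + a1 * D1 f + a2 * D2 f) ->
  0 <= t -> U t theta = a1 * D1 (lk t) + a2 * D2 (lk t).
Proof.
move=> thE t0; rewrite /U thE; last exact: bfun_laplace_kernel.
by rewrite addrAC; congr (_ + _); rewrite addrAC subrr add0r.
Qed.

Let det t s := D1 (lk t) * D2 (lk s) - D2 (lk t) * D1 (lk s).

Lemma hull_moments_independent (t1 t2 : R) : 0 <= t1 -> t1 < t2 -> det t1 t2 != 0 ->
  forall j k, Phi (fun theta => U t1 theta ^+ j * U t2 theta ^+ k) = 0.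
Proof.
move=> t10 t12 dn0; have t20 : 0 < t2 by rewrite (le_lt_trans t10).
(* [Lam] and [Lam'] at [lk t] are the coefficients of d(t) in the basis d(t1), d(t2). As integrals
   against signed measures they inherit right continuity and the propagation of zeros. *)
pose Lam f := (D2 (lk t2) / det t1 t2) * D1 f + (- D1 (lk t2) / det t1 t2) * D2 f.
pose Lam' f := (- D2 (lk t1) / det t1 t2) * D1 f + (D1 (lk t1) / det t1 t2) * D2 f.
have bLam : bpc Lam by exact: bpc_lincomb.
have bLam' : bpc Lam' by exact: bpc_lincomb.
have [Lam1 Lam2 Lam'2] : [/\ Lam (lk t1) = 1, Lam (lk t2) = 0 & Lam' (lk t2) = 1].
  exact: cramer2_unit.
apply: (mixed_moments_eq0 bPhi PhiL (U := U) (t0 := t2)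
  (a := fun t => Lam (lk t)) (b := fun t => Lam' (lk t))).
- exact: bU.
- by apply: bU; exact: ltW.
- by move=> t tt; apply: bU; rewrite ltW// (lt_trans t20).
- move=> t theta tt Lth; have t0 : 0 <= t by rewrite ltW// (lt_trans t20).
  have [a1 [a2 [_ _ _ thE]]] := mean_hullP Lth.
  rewrite !(UE thE)//; last exact: ltW.
  exact: cramer2.
- by move=> t n tt; apply: PhiU; rewrite ltW// (lt_trans t20).
- by rewrite -Lam2; apply: bpc_laplace_cvg => //; exact: ltW.
- by rewrite -Lam'2; apply: bpc_laplace_cvg => //; exact: ltW.
(* If [Lam] vanished on the transforms just right of [t2], it would vanish at [t1 < t2], where it
   equals 1. Halving [e] fits a closed interval into the half-open one. *)
- move=> e e0; apply: contrapT => nex.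
  suff : Lam (lk t1) = 0 by rewrite Lam1 => /eqP; rewrite oner_eq0.
  apply: (laplace_eq0_left (@measurable_max0 R) (@max0_ge0 R) (t0 := t2) (e := e / 2)) => //.
  + by rewrite divr_gt0.
  + by rewrite t10 ltW.
  + move=> t /andP[]; rewrite le_eqVlt => /predU1P[<- _|t2t te]; first exact: Lam2.
    apply/eqP; apply: contrapT => /negP Lt; apply: nex; exists t; split => //.
    by rewrite (le_lt_trans te)// ltrD2l ltr_pdivrMr// mulr2n mulrDr mulr1 ltrDl.
Qed.

(** Supplies two functions with vanishing mixed moments in which every evaluation is affine on [L],
    as [moments_determine] requires. *)
Lemma hull_coordinates : exists u v : probR R -> R,
  [/\ bfun u, bfun v,
    forall j k, Phi (fun theta => u theta ^+ j * v theta ^+ k) = 0 &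
    forall B, measurable B -> exists c a b, forall theta, L theta ->
      \int[theta]_x \1_B x = c + a * u theta + b * v theta].
Proof.
have [[t [s [t0 s0 ds]]]|nd] :=
    pselect (exists t s, [/\ 0 <= t, 0 <= s & det t s != 0]).
  wlog ts : t s t0 s0 ds / t < s.
    move=> wl; have [ts|st|tsE] := ltgtP t s.
    - exact: (wl t s).
    - apply: (wl s t) => //; apply: contra ds => /eqP h.
      have -> : det t s = - det s t by rewrite /det; ring.
      by rewrite h oppr0.
    - by move: ds; rewrite tsE /det [X in X - _]mulrC subrr eqxx.
  exists (U t), (U s); split; [exact: bU|exact: bU| |].
    exact: hull_moments_independent.
  move=> B mB; exists (\int[mu3]_x \1_B x),
    (D2 (lk s) / det t s * D1 \1_B + - D1 (lk s) / det t s * D2 \1_B),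
    (- D2 (lk t) / det t s * D1 \1_B + D1 (lk t) / det t s * D2 \1_B) => theta Lth.
  have [a1 [a2 [_ _ _ thE]]] := mean_hullP Lth.
  rewrite !(UE thE)// thE; last exact: bfun_indic.
  by rewrite -!addrA; congr +%R; exact: cramer2.
have det0 t s : 0 <= t -> 0 <= s -> det t s = 0.
  by move=> t0 s0; apply/eqP; apply: contrapT => /negP h; apply: nd; exists t, s.
(* For fixed [t], the vanishing of [det t s] for all [s] is a linear relation between Laplace
   transforms, so it passes to measurable sets. *)
have par t B : 0 <= t -> measurable B -> D1 (lk t) * D2 \1_B = D2 (lk t) * D1 \1_B.
  move=> t0 mB; apply/eqP; rewrite -subr_eq0 addrC -mulNr; apply/eqP.
  apply: (@lincomb_laplace_eq0 (- D2 (lk t)) (D1 (lk t))) => // s s0.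
  by rewrite -[RHS](det0 t s)// /det; ring.
(* Any [t] with d(t) nonzero will do. If there is none, both signed measures vanish and [a = 0]
   works. *)
have [t [t0 Dt]] : exists t, 0 <= t /\ forall B, measurable B -> exists a,
    D1 \1_B = a * D1 (lk t) /\ D2 \1_B = a * D2 (lk t).
  have [[t [t0 D1t]]|D10] := pselect (exists t, 0 <= t /\ D1 (lk t) != 0).
    exists t; split => // B mB; exists (D1 \1_B / D1 (lk t)); split.
      by rewrite divfK.
    by apply: (mulfI D1t); rewrite (par t B t0 mB) mulrCA mulrC mulrA divfK// mulrC.
  have [[t [t0 D2t]]|D20] := pselect (exists t, 0 <= t /\ D2 (lk t) != 0).
    exists t; split => // B mB; exists (D2 \1_B / D2 (lk t)); split; last by rewrite divfK.
    by apply: (mulfI D2t); rewrite -(par t B t0 mB) mulrCA mulrC mulrA divfK// mulrC.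
  have D1E t : 0 <= t -> D1 (lk t) = 0.
    by move=> t0; apply/eqP; apply: contrapT => /negP h; apply: D10; exists t.
  have D2E t : 0 <= t -> D2 (lk t) = 0.
    by move=> t0; apply/eqP; apply: contrapT => /negP h; apply: D20; exists t.
  exists 0; split => // B mB; exists 0; rewrite !mul0r; split.
    have := @lincomb_laplace_eq0 1 0 _ B mB; rewrite mul1r mul0r addr0; apply.
    by move=> t t0; rewrite D1E// mul0r mulr0 addr0.
  have := @lincomb_laplace_eq0 0 1 _ B mB; rewrite mul1r mul0r add0r; apply.
  by move=> t t0; rewrite D2E// mul0r mulr0 addr0.
(* One coordinate suffices and is used twice; its mixed moments are plain moments of order
   [j + k]. *)
exists (U t), (U t); split; [exact: bU|exact: bU| |].
  move=> j k; rewrite -[RHS](PhiU (j + k) t0); congr Phi.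
  by apply/funext => theta; rewrite exprD.
move=> B mB; have [a [D1B D2B]] := Dt B mB.
exists (\int[mu3]_x \1_B x), a, 0 => theta Lth.
have [a1 [a2 [_ _ _ thE]]] := mean_hullP Lth.
rewrite !(UE thE)// thE; last exact: bfun_indic.
rewrite D1B D2B mul0r addr0 -addrA; congr (_ + _); rewrite [RHS]mulrDr.
by congr (_ + _); rewrite mulrCA.
Qed.

End functionals.
End convex_hull.

(** * Measurability of the hull and equality of the mixing measures *)

Section good_hull.
Context (R : realType) (mu1 mu2 mu3 : probR R).
Hypotheses (mu1_ge0 : mu1 `[0, +oo[%classic = 1%E)
  (mu2_ge0 : mu2 `[0, +oo[%classic = 1%E) (mu3_ge0 : mu3 `[0, +oo[%classic = 1%E).
Local Notation L := (convex_hull3 mu1 mu2 mu3).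
Local Notation lk := (@laplace_kernel R).
Local Notation D1 := (mean_diff mu1 mu3).
Local Notation D2 := (mean_diff mu2 mu3).

(** Laplace transforms at integers determine a measure on [[0, +oo[], so countably many equations
    characterise the hull. *)
Lemma hull_laplaceP (theta : probR R) (a1 a2 : R) :
  theta `[0, +oo[%classic = 1%E -> 0 <= a1 -> 0 <= a2 -> a1 + a2 <= 1 ->
  (forall k : nat, \int[theta]_x lk k%:R x =
    \int[mu3]_x lk k%:R x + a1 * D1 (lk k%:R) + a2 * D2 (lk k%:R)) ->
  L theta.
Proof.
move=> th0 a10 a20 a12 thk; exists a1, a2, (1 - a1 - a2); split => //.
- by ring.
- by lra.
move=> B mB; pose Psi f := 1 * \int[theta]_x f x + (-1) *
    (1 * (a1 * \int[mu1]_x f x + a2 * \int[mu2]_x f x) + (1 - a1 - a2) * \int[mu3]_x f x).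
have bPsi : bpc Psi.
  apply: bpc_lincomb; first exact: bpc_integral.
  apply: bpc_lincomb; last exact: bpc_integral.
  by apply: bpc_lincomb; exact: bpc_integral.
have : Psi \1_B = 0.
  have := laplace_unique (@measurable_max0 R) (@max0_ge0 R) bPsi _ mB.
  rewrite /Psi -!mean_max0//; apply => k.
  by move: (thk k); rewrite /Psi /mean_diff => ->; ring.
rewrite /Psi !mean_indic// mul1r mulN1r => /eqP; rewrite subr_eq0 => /eqP thB.
rewrite -[LHS]fineK ?fin_num_measure// thB.
rewrite -[mu1 B]fineK ?fin_num_measure// -[mu2 B]fineK ?fin_num_measure//.
by rewrite -[mu3 B]fineK ?fin_num_measure// -!EFinM -!EFinD mul1r.
Qed.

Lemma mean_diff_le1 (mu nu : probR R) (k : nat) : `|mean_diff mu nu (lk k%:R)| <= 1.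
Proof.
have h (rho : probR R) : 0 <= \int[rho]_x lk k%:R x <= 1.
  rewrite Rintegral_ge0 => [|x _]; last exact: expR_ge0.
  rewrite (le_trans (ler_norm _))//; apply: norm_mean_le => [|x].
    by have [] := @bfun_laplace_kernel R k%:R (ler0n _ _).
  have /andP[? ?] := laplace_ge0_le1 (@max0_ge0 R) x (ler0n R k).
  by rewrite ger0_norm.
rewrite /mean_diff mul1r mulN1r ler_norml.
by have /andP[? ?] := h mu; have /andP[? ?] := h nu; lra.
Qed.

(* Grid points and integer arguments of the Laplace transform make membership in
   the hull a countable combination of measurable conditions. *)
Let near_grid (m i j k : nat) := [set theta : probR R |
  `|\int[theta]_x lk k%:R x - (\int[mu3]_x lk k%:R x + i%:R / m.+1%:R * D1 (lk k%:R)
    + j%:R / m.+1%:R * D2 (lk k%:R))| <= 2 / m.+1%:R].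

Lemma trunc_div_le (m : nat) (a : R) : 0 <= a ->
  (Num.trunc (m.+1%:R * a))%:R / m.+1%:R <= a <=
  (Num.trunc (m.+1%:R * a))%:R / m.+1%:R + 1 / m.+1%:R.
Proof.
move=> a0; have /andP[h1 h2] := truncn_itv (mulr_ge0 (ler0n R m.+1) a0).
rewrite ler_pdivrMr// [leRHS]mulrC h1/= -mulrDl ler_pdivlMr// [leLHS]mulrC.
by rewrite (le_trans (ltW h2))// -natr1.
Qed.

(** The coefficients are rounded down to multiples of [1 / m.+1], which keeps their sum at most 1.
    Each rounding costs at most [1 / m.+1] because the differences of transforms are bounded by
    1. *)
Lemma hull_near_grid (theta : probR R) : L theta -> forall m, exists i j,
  (i + j <= m.+1)%N /\ forall k, near_grid m i j k theta.
Proof.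
move=> Lth m; have [a1 [a2 [a10 a20 a12 thE]]] := mean_hullP Lth.
exists (Num.trunc (m.+1%:R * a1)), (Num.trunc (m.+1%:R * a2)).
have /andP[i1 i2] := trunc_div_le m a10.
have /andP[j1 j2] := trunc_div_le m a20.
split.
  rewrite -(ler_nat R) natrD -[leRHS]mul1r -ler_pdivrMr//.
  by rewrite mulrDl (le_trans (lerD i1 j1)).

move=> k; rewrite /near_grid /= thE; last exact: bfun_laplace_kernel.
move: i1 i2 j1 j2; set i := (Num.trunc (_ * a1))%:R / _.
set j := (Num.trunc (_ * a2))%:R / _ => i1 i2 j1 j2.
have := mean_diff_le1 mu1 mu3 k; have := mean_diff_le1 mu2 mu3 k.
move: (D1 _) (D2 _) => x1 x2 x21 x11.
set c := \int[mu3]_x _.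
have -> : c + a1 * x1 + a2 * x2 - (c + i * x1 + j * x2) =
    (a1 - i) * x1 + (a2 - j) * x2 by ring.
rewrite (le_trans (ler_normD _ _))// !normrM.
have -> : 2 / m.+1%:R = 1 / m.+1%:R * 1 + 1 / m.+1%:R * 1 :> R by rewrite !mulr1 -mulrDl.
apply: lerD; apply: ler_pM => //.
  by rewrite ger0_norm ?subr_ge0// lerBlDl.
by rewrite ger0_norm ?subr_ge0// lerBlDl.
Qed.

(** A cluster point of the grid points in the compact unit square provides the coefficients; each
    grid point serves all [k] at once. *)
Lemma near_grid_hull (theta : probR R) : theta `[0, +oo[%classic = 1%E ->
  (forall m, exists i j, (i + j <= m.+1)%N /\ forall k, near_grid m i j k theta) ->
  L theta.
Proof.
move=> th0 H.
have /choice[p pP] : forall m, exists p : nat * nat, (p.1 + p.2 <= m.+1)%N /\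
    forall k, near_grid m p.1 p.2 k theta.
  by move=> m; have [i [j ijP]] := H m; exists (i, j).
pose q m : R * R := ((p m).1%:R / m.+1%:R, (p m).2%:R / m.+1%:R).
have q0 m : 0 <= (q m).1 /\ 0 <= (q m).2 by split; rewrite divr_ge0.
have q1 m : (q m).1 + (q m).2 <= 1.
  rewrite /q/= -mulrDl ler_pdivrMr// mul1r -natrD ler_nat.
  by have [] := pP m.
have cpt : compact (`[0, 1]%classic `*` `[0, 1]%classic : set (R * R)).
  by apply: compact_setX; exact: segment_compact.
have Fq : (q @ \oo) (`[0, 1]%classic `*` `[0, 1]%classic).
  exists 0%N => // m _; have [q10 q20] := q0 m; have q12 := q1 m.
  have h1 : 0 <= (q m).1 <= 1 by rewrite q10/= (le_trans _ q12)// lerDl.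
  have h2 : 0 <= (q m).2 <= 1 by rewrite q20/= (le_trans _ q12)// lerDr.
  by split; rewrite /= in_itv; [exact: h1|exact: h2].
have [[a1 a2] [_ clq]] := cpt (q @ \oo) _ Fq.
have eps e : 0 < e -> exists m, [/\ 2 / m.+1%:R <= e, `|a1 - (q m).1| <= e
    & `|a2 - (q m).2| <= e].
  move=> e0.
  have e20 : 0 < e / 2 by rewrite divr_gt0.
  have [N _ HN] := near_infty_natSinv_lt (PosNum e20).
  have FN : (q @ \oo) (q @` [set m | (N <= m)%N]) by exists N => // m Nm; exists m.
  have nb : nbhs (a1, a2) (ball a1 e `*` ball a2 e).
    by exists (ball a1 e, ball a2 e) => //; split; exact: nbhsx_ballx.
  have [_ [[m Nm <-] [b1 b2]]] := clq _ _ FN nb.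
  exists m; split; [|exact: ltW b1|exact: ltW b2].
  by rewrite mulrC -ler_pdivlMr//; apply/ltW; exact: HN.
have lim0 (x : R) (c : R) : 0 <= c -> (forall e, 0 < e -> x <= c * e) -> x <= 0.
  move=> c0 xc; apply/ler_addgt0Pr => e e0; rewrite add0r.
  have c10 : 0 < c + 1 by rewrite ltr_wpDl.
  apply: le_trans (xc (e / (c + 1)) _) _; first by rewrite divr_gt0.
  by rewrite mulrCA ger_pMr// ler_pdivrMr// mul1r lerDl.
apply: (@hull_laplaceP theta a1 a2 th0).
- rewrite -oppr_le0; apply: (@lim0 _ 1) => // e e0; rewrite mul1r.
  have [m [_ + _]] := eps e e0; have [? _] := q0 m.
  by rewrite ler_norml => /andP[? ?]; lra.
- rewrite -oppr_le0; apply: (@lim0 _ 1) => // e e0; rewrite mul1r.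
  have [m [_ _ +]] := eps e e0; have [_ ?] := q0 m.
  by rewrite ler_norml => /andP[? ?]; lra.
- rewrite -subr_le0; apply: (@lim0 _ 2) => // e e0.
  have [m [_ + +]] := eps e e0; have ? := q1 m.
  by rewrite !ler_norml => /andP[? ?] /andP[? ?]; lra.
(* One [e] comes from the grid error and one from moving each of the two coefficients to the cluster
   point. *)
move=> k; apply/eqP; rewrite -subr_eq0 -normr_le0; apply: (@lim0 _ 3) => // e e0.
have [m [me qm1 qm2]] := eps e e0.
have [_ /(_ k)] := pP m; rewrite /near_grid /= => /le_trans/(_ me).
move: qm1 qm2; rewrite /q /=; move: ((p m).1%:R / _) ((p m).2%:R / _) => i j qm1 qm2.
have := mean_diff_le1 mu1 mu3 k; have := mean_diff_le1 mu2 mu3 k.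
move: (D1 _) (D2 _) (\int[theta]_x _) (\int[mu3]_x _) => x1 x2 y c x21 x11 yc.
have -> : y - (c + a1 * x1 + a2 * x2) =
    (y - (c + i * x1 + j * x2)) - (a1 - i) * x1 - (a2 - j) * x2 by ring.
have -> : 3 * e = e + e * 1 + e * 1 by ring.
apply: (le_trans (ler_normB _ _)); apply: lerD; last by rewrite normrM ler_pM.
by apply: (le_trans (ler_normB _ _)); apply: lerD; rewrite // normrM ler_pM.
Qed.

Lemma measurable_hull : measurable (L : set (probR R)).
Proof.
(* The condition on [[0, +oo[] is listed separately because the truncated kernel cannot tell
   negative points from 0. *)
have -> : L = [set theta : probR R | theta `[0, +oo[%classic = 1%E] `&`
    \bigcap_m \bigcup_i \bigcup_(j in [set j | (i + j <= m.+1)%N])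
      \bigcap_k near_grid m i j k.
  apply/seteqP; split => [theta Lth|theta [th0 H]].
    split; first exact: (hull_ge0 mu1_ge0 mu2_ge0 mu3_ge0 Lth).
    move=> m _; have [i [j [ij Hk]]] := hull_near_grid Lth m.
    by exists i => //; exists j => // k _; exact: Hk.
  apply: near_grid_hull => // m; have [i _ [j ij Hk]] := H m I.
  by exists i, j; split => // k; exact: Hk.
apply: measurableI.
  rewrite (_ : [set _ | _] = (fun theta : probR R => theta `[0, +oo[%classic) @^-1` [set 1%E])//.
  rewrite -[X in measurable X]setTI; apply: measurable_fun_evaluation => //.
apply: bigcapT_measurable => m; apply: bigcup_measurable => i _.
apply: bigcup_measurable => j _; apply: bigcapT_measurable => k.
rewrite /near_grid -[X in measurable X]setTI.
apply: measurable_fun_le => //.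
apply: measurableT_comp => //; apply: measurable_funB => //.
by have [] := bfun_mean (@bfun_laplace_kernel R k%:R (ler0n _ _)).
Qed.

Lemma good_hull : good L.
Proof.
split; first exact: measurable_hull.
move=> Th1 Th2 Th1L Th2L d1 d2 T1 T2 P1 P2 X Y iidX iidY XY.
have Lge0 := hull_ge0 mu1_ge0 mu2_ge0 mu3_ge0.
have same := iid_same_moments measurable_hull Lge0 Th1L Th2L iidX iidY XY.
pose Phi f := 1 * \int[Th1]_theta f theta + (-1) * \int[Th2]_theta f theta.
have bPhi : bpc Phi by apply: bpc_lincomb; exact: bpc_integral.
have PhiL f g : bfun f -> bfun g -> (forall theta, L theta -> f theta = g theta) ->
    Phi f = Phi g.
  move=> bf bg fg; rewrite /Phi (mean_ext measurable_hull Th1L bf bg fg).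
  by rewrite (mean_ext measurable_hull Th2L bf bg fg).
have Phi_laplace t n : 0 <= t ->
    Phi (fun theta => (\int[theta]_x lk t x) ^+ n) = 0.
  by move=> t0; rewrite /Phi same// mul1r mulN1r subrr.
have [u [v [bu bv uv0 coord]]] :=
  hull_coordinates mu1_ge0 mu2_ge0 mu3_ge0 bPhi PhiL Phi_laplace.
(* The evaluations at Borel sets, whose level sets generate the sigma-algebra on the space of
   measures. *)
pose G := [set (fun theta : probR R => \int[theta]_x \1_B x) | B in @measurable _ R].
have GX X0 : G X0 -> [/\ measurable_fun setT X0, forall theta, 0 <= X0 theta <= 1 &
    exists c a b, forall theta, L theta -> X0 theta = c + a * u theta + b * v theta].
  move=> [B mB <-]; split; last exact: coord.
    by have [] := bfun_mean (bfun_indic R mB).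
  move=> theta; rewrite mean_indic// fine_ge0//= -lee_fin fineK ?fin_num_measure//.
  exact: probability_le1.
have Phi0 := moments_determine bPhi PhiL bu bv uv0 GX.
move=> A mA.
have : Phi \1_A = 0.
  apply: Phi0; move: A mA; apply: smallest_sub; first exact: smallest_sigma_algebra.
  move=> _ [r _ [U mU <-]]; apply: sub_sigma_algebra => /=.
  exists (fun theta : probR R => \int[theta]_x \1_U x); first by exists U.
  exists `]-oo, r[%classic; first exact: measurable_itv.
  apply/seteqP; split => theta; rewrite /mset /= in_itv/= mean_indic//.
    by rewrite -lte_fin fineK// fin_num_measure.
  by rewrite -lte_fin fineK// fin_num_measure.
rewrite /Phi !mean_indic// mul1r mulN1r => /eqP; rewrite subr_eq0 => /eqP ThA.
by rewrite -[LHS]fineK ?fin_num_measure// ThA fineK// fin_num_measure.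
Qed.

End good_hull.

(** * Measures supported in {0, 1, 2} *)

Lemma dirac_supported_ge0 (R : realType) (a : R) : 0 <= a ->
  (\d_a : probR R) `[0, +oo[%classic = 1%E.
Proof. by move=> a0; rewrite /= diracE mem_set//= in_itv/= a0. Qed.

Lemma supported_in_012 (R : realType) :
  (supported_in [set 0; 1; 2%:R] : set (probR R)) =
  convex_hull3 (\d_(0 : R) : probR R) (\d_(1 : R) : probR R) (\d_(2%:R : R) : probR R).
Proof.
pose S : set R := [set 0; 1; 2%:R].
have mS : measurable S.
  by apply: measurableU => //; apply: measurableU.
have n01 : (0 : R) != 1 by rewrite eq_sym oner_eq0.
have n02 : (0 : R) != 2%:R by rewrite eq_sym pnatr_eq0.
have n12 : (1 : R) != 2%:R by rewrite -[1]/(1%:R) eqr_nat.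
apply/seteqP; split => theta; rewrite /supported_in/=.
- move=> thS; pose a (i : R) := fine (theta [set i]).
  have thE B : measurable B ->
      fine (theta B) = a 0 * \1_B 0 + a 1 * \1_B 1 + a 2%:R * \1_B 2%:R.
    move=> mB; rewrite -mean_indic//.
    have bi (i : R) : bfun (\1_[set i] : R -> R) by exact: bfun_indic.
    (* The coefficients are the masses of the atoms: on the support, the indicator of [B] is a
       combination of the indicators of the three points. *)
    have aE i : a i = \int[theta]_x \1_[set i] x by rewrite mean_indic.
    rewrite (mean_ext (g := fun x : R => \1_B 0 * \1_[set 0] x + \1_B 1 * \1_[set 1] x +
        \1_B 2%:R * \1_[set 2%:R] x) mS thS).
    + rewrite !(bpcD (bpc_integral theta)) ?(bpcZ _ (bpc_integral theta))//;
        do ?[exact: bfunZ|apply: bfunD; exact: bfunZ].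
      by rewrite !aE; ring.
    + exact: bfun_indic.
    + by do 2?[apply: bfunD]; exact: bfunZ.
    + have i1 (x y : R) : \1_[set x] y = (y == x)%:R :> R.
        rewrite indicE (_ : (y \in [set x]) = (y == x))//.
        by apply/idP/eqP; rewrite inE.
      move=> x; rewrite !i1 => -[[->|->]|->].
      * by rewrite eqxx (negPf n01) (negPf n02) !mulr0 mulr1 !addr0.
      * by rewrite eqxx eq_sym (negPf n01) (negPf n12) !mulr0 mulr1 addr0 add0r.
      * by rewrite eqxx ![2%:R == _]eq_sym (negPf n02) (negPf n12) !mulr0 mulr1 !add0r.
  exists (a 0), (a 1), (a 2%:R); split.
  + have := thE setT measurableT; rewrite indicT /cst !mulr1 => <-.
    by rewrite [X in fine X]probability_setT.
  + by rewrite fine_ge0.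
  + by rewrite fine_ge0.
  + by rewrite fine_ge0.
  + move=> B mB; rewrite -[LHS]fineK ?fin_num_measure// thE//.
- move=> [a1 [a2 [a3 [a123 _ _ _ thE]]]].
  have dS i : S i -> (\d_i : probR R) S = 1%E by move=> Si; rewrite /= diracE mem_set.
  rewrite thE//.
  have [-> -> ->] : [/\ (\d_(0 : R) : probR R) S = 1%E, (\d_(1 : R) : probR R) S = 1%E
      & (\d_(2%:R : R) : probR R) S = 1%E].
    by split; apply: dS; [left; left|left; right|right].
  by rewrite !mule1 -!EFinD a123.
Qed.

Theorem proposition2p2p2 (R : realType) :
  good (supported_in [set 0; 1; 2%:R] : set (probR R)) /\
  (forall mu1 mu2 mu3 : probR R,
     supported_in `[0, +oo[ mu1 ->
     supported_in `[0, +oo[ mu2 ->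
     supported_in `[0, +oo[ mu3 ->
     good (convex_hull3 mu1 mu2 mu3)).
Proof.
split; last by move=> mu1 mu2 mu3; exact: good_hull.
by rewrite supported_in_012; apply: good_hull; apply: dirac_supported_ge0.
Qed.
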